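(* For every $n\in\{4,5\}$ and every integer $k\ge 1$, $GR_k(C_{2n+1}) = n\cdot 2^k+1$. Equivalently: every Gallai $k$-coloring of the edges of the complete graph $K_{n\cdot 2^k+1}$ contains a monochromatic cycle of length $2n+1$, and there is a Gallai $k$-coloring of $K_{n\cdot 2^k}$ with no monochromatic cycle of length $2n+1$. In particular, $GR_k(C_9)=4\cdot 2^k+1$ and $GR_k(C_{11})=5\cdot 2^k+1$ for all $k\ge1$.
   Context: All graphs are finite and simple. $K_m$ denotes the complete graph on $m$ vertices and $C_m$ the cycle on $m$ vertices. A Gallai coloring is a coloring of the edges of a complete graph with no rainbow triangle (a triangle whose three edges receive three distinct colors). A Gallai $k$-coloring is a Gallai coloring using (at most) $k$ colors. For an integer $k\ge1$ and a graph $H$, the Gallai-Ramsey number $GR_k(H)$ is the least positive integer $N$ such that every Gallai $k$-coloring of $K_N$ contains a monochromatic copy of $H$. *)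

(* Defs.v *)
From mathcomp Require Import all_boot.

Set Implicit Arguments.
Unset Strict Implicit.
Unset Printing Implicit Defensive.

Record sgraph := SGraph {
  vertex : finType;
  adj : rel vertex;
  adj_sym : symmetric adj;
  adj_irr : irreflexive adj }.

(* [ordS u] is u + 1 modulo m. The conjunct [u != v] only matters for m = 1,
   where it removes the loop; for m >= 3 this is the usual cycle C_m. *)
Definition cycle_adj (m : nat) : rel 'I_m :=
  fun u v => (u != v) && ((v == ordS u) || (u == ordS v)).

Lemma cycle_adj_sym m : symmetric (@cycle_adj m).
Proof. by move=> u v; rewrite /cycle_adj eq_sym orbC. Qed.

Lemma cycle_adj_irr m : irreflexive (@cycle_adj m).
Proof. by move=> u; rewrite /cycle_adj eqxx. Qed.

Definition cycle_graph (m : nat) : sgraph :=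
  SGraph (@cycle_adj_sym m) (@cycle_adj_irr m).

(* An edge coloring of K_N with at most k colors is a symmetric map
   c : 'I_N -> 'I_N -> 'I_k; its values on the diagonal carry no meaning and
   are never used below. *)
Definition rainbow_triangle (N k : nat) (c : 'I_N -> 'I_N -> 'I_k)
    (x y z : 'I_N) : bool :=
  [&& x != y, y != z, x != z,
      c x y != c y z, c y z != c x z & c x y != c x z].

Definition gallai_coloring (N k : nat) (c : 'I_N -> 'I_N -> 'I_k) : Prop :=
  (forall x y, c x y = c y x) /\ (forall x y z, ~~ rainbow_triangle c x y z).

(* The copy need not be induced. *)
Definition has_mono_copy (N k : nat) (c : 'I_N -> 'I_N -> 'I_k)
    (H : sgraph) : Prop :=
  exists (i : 'I_k) (f : vertex H -> 'I_N),
    injective f /\ forall u v, adj u v -> c (f u) (f v) = i.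

Definition gallai_arrow (k : nat) (H : sgraph) (N : nat) : Prop :=
  forall c : 'I_N -> 'I_N -> 'I_k, gallai_coloring c -> has_mono_copy c H.

(* GR_k(H) = N, with GR_k(H) given by its graph: N is the least positive
   integer with the arrow property. *)
Definition is_gallai_ramsey (k : nat) (H : sgraph) (N : nat) : Prop :=
  [/\ 0 < N, gallai_arrow k H N
    & forall M, 0 < M -> gallai_arrow k H M -> N <= M].

(* Main.v *)
Require Import Defs.
From mathcomp Require Import all_boot.
From mathcomp Require Import zify.

(* The upper bound is proved by induction on a vertex set [A] together with sets
   [X i] of fewer than [n] outside vertices joined to all of [A] in color [i]:
   if [S] is the set of colors used on [A], then [|A| + \sum_(i in S) |X i|] is
   at most [n * 2 ^ |S|].  Take a Gallai partition of [A] with reduced colors red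
   and blue.  A part with more than [n] vertices that is joined in red to [n]
   vertices contains no red edge, so each reduced color either dies inside such a
   part, which halves the bound, or leaves fewer than [n] vertices, which are
   moved to [X].  If all parts are small, a largest part [P] is joined in one
   color, say red, to a large set [R]; red linear forests in [R] are then short,
   so almost all pairs in [R] are blue and Dirac's theorem gives a blue cycle.
   This last count is the only place that needs [n <= 5].

   With two colors the bound is the Ramsey number of the odd cycle.  On [4n + 1]
   vertices depth-first search yields a monochromatic cycle of length at least
   [2n + 1].  A monochromatic [C_L] yields a monochromatic [C_(L-1)] on the same
   vertices unless [L] is even and the even and the odd vertices span cliques of
   the other color; those cliques then force a monochromatic [C_(2n+1)]. *)

Set Implicit Arguments.
Unset Strict Implicit.
Unset Printing Implicit Defensive.

(** * Paths and cycles *)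

Ltac arith :=
  repeat match goal with
  | H : ?T |- _ => lazymatch T with
    | is_true (leq _ _) => fail
    | is_true (leq _ _ && leq _ _) => fail
    | @eq nat _ _ => fail
    | _ => clear H
    end
  end; lia.

Definition has_cycle (V : eqType) (e : rel V) (l : nat) : Prop :=
  exists s : seq V, [/\ uniq s, size s = l & cycle e s].

(* The length [l] counts edges. *)
Definition link (V : finType) (e : rel V) (D : {set V}) (l : nat) (x y : V) :
    Prop :=
  exists s : seq V, [/\ uniq (x :: s), path e x s, last x s = y, size s = l
    & {subset x :: s <= D}].

Lemma card_between (T : finType) (B A : {set T}) k :
  B \subset A -> #|B| <= k -> k <= #|A| ->
  exists C : {set T}, [/\ B \subset C, C \subset A & #|C| = k].
Proof.
move=> BA Bk; elim: k Bk => [|k IH] Bk kA.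
  by exists B; split=> //; apply/eqP; rewrite -leqn0.
have [E|Bk'] := eqVneq #|B| k.+1; first by exists B.
have [||C [BC CA Ck]] := IH; [by lia | by lia |].
have /subsetPn[x xA xC] : ~~ (A \subset C).
  by apply: contraL kA => /subset_leq_card; rewrite Ck -ltnNge.
exists (x |: C); split.
- exact: subset_trans BC (subsetUr _ _).
- by rewrite subUset sub1set xA.
- by rewrite cardsU1 xC Ck.
Qed.

Lemma cycle_last (V : eqType) (e : rel V) x s :
  cycle e (x :: s) = path e x s && e (last x s) x.
Proof. by rewrite /cycle rcons_path. Qed.

Section Links.
Variables (V : finType) (e : rel V).
Implicit Types (D X Y W : {set V}) (x y z : V) (s : seq V).

Lemma link1 D x : x \in D -> link e D 0 x x.
Proof. by move=> xD; exists [::]; split=> //= y; rewrite inE => /eqP->. Qed.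

Lemma link_sub D D' l x y : D \subset D' -> link e D l x y -> link e D' l x y.
Proof.
move=> /subsetP DD' [s [us ps ls ss sD]]; exists s; split=> // z zs.
exact/DD'/sD.
Qed.

Lemma link_cat D D' l l' x y y' z :
  [disjoint D & D'] -> e y y' -> link e D l x y -> link e D' l' y' z ->
  link e (D :|: D') (l + l').+1 x z.
Proof.
move=> dD yy' [s [us ps ls ss sD]] [s' [us' ps' ls' ss' sD']].
exists (s ++ y' :: s'); split.
- rewrite -cat_cons cat_uniq us us' andbT; apply/hasPn => w ws'.
  apply/negP => ws; have /(disjointFr dD) := sD _ ws.
  by rewrite (sD' _ ws').
- by rewrite cat_path ps /= ls yy'.
- by rewrite last_cat.
- by rewrite size_cat /= ss ss' addnS.
- move=> w; rewrite -cat_cons mem_cat in_setU.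
  by case/orP=> [/sD->|/sD'->]; rewrite ?orbT.
Qed.

Lemma link_cycle D l x y : link e D l x y -> e y x -> has_cycle e l.+1.
Proof.
move=> [s [us ps ls ss _]] yx; exists (x :: s); split=> //; first by rewrite /= ss.
by rewrite cycle_last ps ls.
Qed.

Lemma link_cycle2 D D' l l' x y x' y' :
  [disjoint D & D'] -> link e D l x y -> link e D' l' x' y' ->
  e y x' -> e y' x -> has_cycle e (l + l').+2.
Proof.
by move=> dD lD lD' yx' y'x; apply: link_cycle (link_cat dD yx' lD lD') y'x.
Qed.

Hypothesis esym : symmetric e.

Lemma link_rev D l x y : link e D l x y -> link e D l y x.
Proof.
move=> [s [us ps ls ss sD]]; exists (rev (belast x s)).
have Er : y :: rev (belast x s) = rev (x :: s) by rewrite (lastI x s) ls rev_rcons.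
split.
- by rewrite Er rev_uniq.
- by rewrite -ls rev_path -(eq_path (e := e)) // => u v; rewrite esym.
- by case: (s) ls => [|a s'] /= ls; rewrite ?rev_cons ?last_rcons.
- by rewrite size_rev size_belast.
- by move=> w; rewrite Er mem_rev; apply: sD.
Qed.

Lemma link_XY X Y j x y :
  [disjoint X & Y] -> {in X & Y, forall u v, e u v} -> x \in X -> y \in Y ->
  j < #|X| -> j < #|Y| -> link e (X :|: Y) j.*2.+1 x y.
Proof.
elim: j X Y x => [|j IH] X Y x dXY eXY xX yY jX jY.
  have := link_cat dXY (eXY _ _ xX yY) (link1 xX) (link1 yY); exact.
have [x1] : exists x1, x1 \in X :\ x.
  by apply/card_gt0P; move: jX; rewrite (cardsD1 x) xX; arith.
have [y1] : exists y1, y1 \in Y :\ y.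
  by apply/card_gt0P; move: jY; rewrite (cardsD1 y) yY; arith.
rewrite !inE => /andP[y1y y1Y] /andP[x1x x1X].
have dXY' : [disjoint X :\ x & Y :\ y1].
  by apply: disjointWl (subsetDl _ _) _; apply: disjointWr (subsetDl _ _) _.
have L : link e (X :\ x :|: Y :\ y1) j.*2.+1 x1 y.
  apply: IH => //.
  - by move=> u v /setD1P[_ uX] /setD1P[_ vY]; apply: eXY.
  - by rewrite !inE x1x.
  - by rewrite !inE eq_sym y1y.
  - by move: jX; rewrite (cardsD1 x) xX; arith.
  - by move: jY; rewrite (cardsD1 y1) y1Y; arith.
have xNY : x \notin Y by rewrite (disjointFr dXY xX).
have y1NX : y1 \notin X by rewrite (disjointFl dXY y1Y).
have d1 : [disjoint [set y1] & X :\ x :|: Y :\ y1].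
  by rewrite disjoints1 !inE eqxx (negPf y1NX) andbF.
have d2 : [disjoint [set x] & [set y1] :|: (X :\ x :|: Y :\ y1)].
  rewrite disjoints1 !inE eqxx (negPf xNY) !andbF !orbF.
  by apply: contraNneq xNY => ->.
have := link_cat d1 _ (link1 (set11 _)) L.
rewrite esym eXY // => /(_ isT) L1.
have := link_cat d2 _ (link1 (set11 _)) L1.
rewrite eXY // => /(_ isT); apply: link_sub.
apply/subsetP => z; rewrite !inE => /or3P[/eqP->|/eqP->|/orP[]/andP[_ ->]] //.
- by rewrite xX.
- by rewrite y1Y orbT.
- by rewrite orbT.
Qed.

Lemma link_XX X Y j x x' :
  [disjoint X & Y] -> {in X & Y, forall u v, e u v} ->
  x \in X -> x' \in X -> x != x' -> j.+1 < #|X| -> j < #|Y| ->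
  link e (X :|: Y) j.*2.+2 x x'.
Proof.
move=> dXY eXY xX x'X xx' jX jY.
have [y yY] : exists y, y \in Y by apply/card_gt0P; arith.
have dXY' : [disjoint X :\ x' & Y] by apply: disjointWl (subsetDl _ _) dXY.
have L : link e (X :\ x' :|: Y) j.*2.+1 x y.
  apply: link_XY => //.
  - by move=> u v /setD1P[_ uX]; apply: eXY.
  - by rewrite !inE xx'.
  - by move: jX; rewrite (cardsD1 x') x'X; arith.
have d1 : [disjoint X :\ x' :|: Y & [set x']].
  by rewrite disjoint_sym disjoints1 !inE eqxx /= (disjointFr dXY x'X).
have := link_cat d1 _ L (link1 (set11 _)).
rewrite esym eXY // => /(_ isT); rewrite addn0; apply: link_sub.
by apply/subsetP => z; rewrite !inE => /orP[/orP[/andP[_ ->]|->]|/eqP->];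
  rewrite ?x'X ?orbT.
Qed.

Lemma link_clique X j x x' :
  {in X &, forall u v, u != v -> e u v} -> x \in X -> x' \in X -> x != x' ->
  j.+1 < #|X| -> link e X j.+1 x x'.
Proof.
elim: j X x => [|j IH] X x eX xX x'X xx' jX.
  exists [:: x']; split=> //=; rewrite ?inE ?andbT //; first exact: eX.
  by move=> z; rewrite !inE => /orP[]/eqP->.
have [y] : exists y, y \in X :\ x :\ x'.
  apply/card_gt0P; move: jX.
  by rewrite (cardsD1 x) (cardsD1 x') xX !inE eq_sym xx' x'X; arith.
rewrite !inE => /and3P[yx' yx yX].
have L : link e (X :\ x) j.+1 y x'.
  apply: IH => //; rewrite ?inE ?yx ?(eq_sym x') ?xx' //.
    by move=> u v /setD1P[_ uX] /setD1P[_ vX]; apply: eX.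
  by move: jX; rewrite (cardsD1 x) xX; arith.
have d1 : [disjoint [set x] & X :\ x] by rewrite disjoints1 !inE eqxx.
have := link_cat d1 _ (link1 (set11 x)) L.
by rewrite eX 1?eq_sym // => /(_ isT); rewrite setD1K.
Qed.

End Links.

(** * Dirac's theorem *)

Section Dirac.
Variables (V : finType) (e : rel V).
Hypothesis esym : symmetric e.
Implicit Types (W : {set V}) (x y z : V) (s : seq V).

Fixpoint bad_steps x s : nat :=
  if s is y :: s' then ~~ e x y + bad_steps y s' else 0.

Lemma bad_steps_cat x s1 s2 :
  bad_steps x (s1 ++ s2) = bad_steps x s1 + bad_steps (last x s1) s2.
Proof. by elim: s1 x => //= y s1 IH x; rewrite IH addnA. Qed.

Lemma bad_steps_rcons x s y :
  bad_steps x (rcons s y) = bad_steps x s + ~~ e (last x s) y.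
Proof. by rewrite -cats1 bad_steps_cat /= addn0. Qed.

Lemma bad_steps_rev x s : bad_steps (last x s) (rev (belast x s)) = bad_steps x s.
Proof.
elim: s x => //= y s IH x.
rewrite rev_cons bad_steps_rcons IH addnC esym.
by case: s {IH} => //= z s; rewrite rev_cons last_rcons.
Qed.

Lemma bad_steps0 x s : (bad_steps x s == 0) = path e x s.
Proof. by elim: s x => //= y s IH x; rewrite addn_eq0 IH; case: (e x y). Qed.

Lemma bad_stepP x s : 0 < bad_steps x s ->
  exists s1 y s2, s = s1 ++ y :: s2 /\ ~~ e (last x s1) y.
Proof.
elim: s x => //= y s IH x; case exy: (e x y) => /=; last first.
  by move=> _; exists [::], y, s; rewrite /= exy.
rewrite add0n => /IH[s1 [z [s2 [-> nz]]]].
by exists (y :: s1), z, s2.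
Qed.

Lemma consecutive_pigeonhole (a b : pred V) x s :
  size s < count a (belast x s) + count b s ->
  exists s1 y s2, [/\ s = s1 ++ y :: s2, a (last x s1) & b y].
Proof.
elim: s x => //= y s IH x; case axy: (a x && b y) => H.
  by case/andP: axy => ax by_; exists [::], y, s.
have [|s1 [z [s2 [-> a1 bz]]]] := IH y; last by exists (y :: s1), z, s2.
by move: H axy; case: (a x); case: (b y) => //=; arith.
Qed.

(* Reversing a segment of a cyclic order removes a non-adjacent consecutive
   pair and creates none. *)
Lemma Dirac W :
  {in W, forall x, #|W| <= (#|[set y in W | (y != x) && e x y]|).*2} ->
  0 < #|W| -> has_cycle e #|W|.
Proof.
move=> degW W0.
have main m x s : bad_steps x (rcons s x) <= m -> perm_eq (x :: s) (enum W) ->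
    exists x' s', bad_steps x' (rcons s' x') = 0 /\ perm_eq (x' :: s') (enum W).
  elim: m x s => [|m IH] x s; first by rewrite leqn0 => /eqP H ?; exists x, s.
  have [B0|] := posnP (bad_steps x (rcons s x)); last first.
    move=> B0 Bm pW.
    have [y [t [pW' ny Bt]]] : exists y t, [/\ perm_eq (y :: t) (enum W),
        ~~ e (last y t) y & bad_steps y t <= m].
      have [s1 [y [s2 [Es ny]]]] := bad_stepP B0.
      move: Bm; rewrite Es bad_steps_cat /= ny /= => Bm.
      case/lastP: s2 => [|s2 z] in Es Bm.
        move/eqP: Es; rewrite cats1 eqseq_rcons => /andP[/eqP ? /eqP ?]; subst.
        by exists y, s1; split=> //; move: Bm => /=; arith.
      move/eqP: Es; rewrite -rcons_cons -rcons_cat eqseq_rcons.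
      case/andP=> /eqP ? /eqP ?; subst.
      exists y, (s2 ++ z :: s1); split.
      - by apply: perm_trans pW; rewrite -!cat_cons perm_catC.
      - by rewrite last_cat.
      - by move: Bm; rewrite bad_steps_cat bad_steps_rcons /=; arith.
    have uyt : uniq (y :: t) by rewrite (perm_uniq pW') enum_uniq.
    have memW w : (w \in y :: t) = (w \in W) by rewrite (perm_mem pW') mem_enum.
    have sz : #|W| = (size t).+1 by rewrite cardE -(perm_size pW').
    set z := last y t in ny.
    have zW : z \in W by rewrite -memW mem_last.
    have yW : y \in W by rewrite -memW mem_head.
    have cz : #|[set w in W | (w != z) && e z w]| <= count (e z) (belast y t).
      rewrite -size_filter cardE; apply: uniq_leq_size (enum_uniq _) _ => w.
      rewrite mem_enum inE mem_filter -memW lastI mem_rcons inE -/z.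
      by case/and3P=> /orP[/eqP->|->]; rewrite ?eqxx // => _ ->.
    have cy : #|[set w in W | (w != y) && e y w]| <= count (e y) t.
      rewrite -size_filter cardE; apply: uniq_leq_size (enum_uniq _) _ => w.
      rewrite mem_enum inE mem_filter -memW inE.
      by case/and3P=> /orP[/eqP->|->]; rewrite ?eqxx // => _ ->.
    have [|t1 [b [t2 [Et za yb]]]] :=
      @consecutive_pigeonhole (e z) (e y) y t.
      by have := degW _ zW; have := degW _ yW; arith.
    apply: (IH y (t1 ++ rev (b :: t2))).
      rewrite rcons_cat bad_steps_cat bad_steps_rcons.
      have : bad_steps y t = bad_steps y t1 + (~~ e (last y t1) b
          + bad_steps b t2) by rewrite Et bad_steps_cat.
      have Ez : z = last b t2 by rewrite /z Et last_cat.
      move=> Bt'; rewrite -(bad_steps_rev b t2) -Ez in Bt'.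
      rewrite lastI -Ez rev_rcons /= esym za add0n.
      have -> : e (last z (rev (belast b t2))) y.
        case: (t2) Ez => [|c t3] /= Ez; first by rewrite Ez esym.
        by rewrite rev_cons last_rcons esym.
      by rewrite addn0; apply: leq_trans Bt; rewrite Bt' addnCA leq_addl.
    apply: perm_trans pW'; rewrite Et perm_cons perm_cat2l perm_sym.
    by rewrite perm_sym perm_rev.
  by exists x, s.
case Ew: (enum W) => [|x s]; first by move: W0; rewrite cardE Ew.
have [|x' [s' [B0 pW]]] := main _ x s (leqnn _); first by rewrite Ew.
exists (x' :: s'); split.
- by rewrite (perm_uniq pW) enum_uniq.
- by rewrite (perm_size pW) cardE.
- by rewrite /cycle -bad_steps0 B0.
Qed.

Lemma Dirac_sub n W : 2 * n + 1 <= #|W| ->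
  {in W, forall x, #|[set y in W | (y == x) || ~~ e x y]| <= n} ->
  has_cycle e (2 * n + 1).
Proof.
move=> cW degW.
have [|C [_ CW Cc]] := card_between (sub0set W) _ cW; first by rewrite cards0.
rewrite -Cc; apply: Dirac => [x xC|]; last by rewrite Cc addn1.
rewrite Cc.
have := cardsID [set y | (y == x) || ~~ e x y] C.
have -> : C :\: [set y | (y == x) || ~~ e x y] = [set y in C | (y != x) && e x y].
  by apply/setP => y; rewrite !inE negb_or negbK andbC.
have : #|C :&: [set y | (y == x) || ~~ e x y]| <= n.
  apply: leq_trans (degW x (subsetP CW x xC)); apply/subset_leq_card/subsetP => y.
  by rewrite !inE => /andP[/(subsetP CW)->].
by rewrite Cc; arith.
Qed.

End Dirac.

(** * Long monochromatic cycles *)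

Lemma clique_join_cycle (V : finType) (e : rel V) (K W : {set V}) n :
  symmetric e -> 0 < n -> K \subset W -> n < #|K| -> 2 * n + 1 <= #|W| ->
  {in K & W, forall x y, x != y -> e x y} -> has_cycle e (2 * n + 1).
Proof.
move=> esym n0 KW cK cW eKW.
have [|K' [_ K'K cK']] := card_between (sub0set K) _ cK; first by rewrite cards0.
have [|C [K'C CW cC]] := card_between (subset_trans K'K KW) _ cW.
  by rewrite cK'; arith.
apply: (Dirac_sub esym (n := n) (W := C)) => [|x xC]; first by rewrite cC.
case xK: (x \in K').
  apply: leq_trans n0; rewrite -(cards1 x); apply/subset_leq_card/subsetP => y.
  rewrite !inE => /andP[yC] /orP[//|]; apply: contraR => yx.
  by apply: eKW; rewrite 1?eq_sym ?(subsetP K'K) ?(subsetP CW).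
have <- : #|C :\: K'| = n.
  by rewrite cardsD (setIidPr K'C) cC cK'; arith.
apply/subset_leq_card/subsetP => y; rewrite !inE => /andP[yC H].
rewrite yC andbT; apply: contraL H => yK; rewrite negb_or negbK.
have xy : y != x by apply: contraFneq xK => <-.
by rewrite xy esym eKW ?(subsetP K'K) ?(subsetP CW).
Qed.

Lemma disjointsU1 (T : finType) (x : T) (A B : {set T}) :
  [disjoint x |: A & B] = (x \notin B) && [disjoint A & B].
Proof. by rewrite -disjointU1; apply: eq_disjoint => y; rewrite !inE. Qed.

Section DepthFirst.
Variables (V : finType) (e : rel V).
Hypothesis esym : symmetric e.

(* Depth-first search: [p] is the current branch, [S] the vertices already
   left, [U] those not yet reached. Each step lowers [#|U| - #|S|] by one. *)
Lemma path_cut (A : {set V}) :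
  exists (p : seq V) (S U : {set V}),
  [/\ uniq p, sorted e p, A = [set x in p] :|: S :|: U,
      #|A| = size p + (#|S|).*2 & #|U| = #|S|] /\
  [/\ {in S & U, forall x y, ~~ e x y}, [disjoint S & U],
      [disjoint [set x in p] & S] & [disjoint [set x in p] & U]].
Proof.
have main d : d <= #|A| -> exists (p : seq V) (S U : {set V}),
  [/\ uniq p, sorted e p, A = [set x in p] :|: S :|: U,
      #|A| = size p + #|S| + #|U| & #|U| + d = #|S| + #|A|] /\
  [/\ {in S & U, forall x y, ~~ e x y}, [disjoint S & U],
      [disjoint [set x in p] & S] & [disjoint [set x in p] & U]].
  elim: d => [_|d IH dA].
    exists [::], set0, A; split; split=> //; rewrite ?set_nil ?setU0 ?set0U //.
    - by rewrite cards0.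
    - by rewrite cards0 addn0.
    - by move=> x y; rewrite inE.
    - by rewrite -setI_eq0 set0I.
    - by rewrite -setI_eq0 setI0.
    - by rewrite -setI_eq0 set0I.
  have [|p [S [U [[up sp EA cA cU] [nSU dSU dpS dpU]]]]] := IH; first by arith.
  have [u /andP[/= uU reach]|no_next] := pickP [pred u | (u \in U) &&
      (if p is x :: _ then e x u else true)].
    have uNp : u \notin p by have := disjointFl dpU uU; rewrite inE => ->.
    have uNS : u \notin S by rewrite (disjointFl dSU uU).
    exists (u :: p), S, (U :\ u); split; split.
    - by rewrite /= uNp.
    - by case: (p) sp reach {uNp} => //= x p' -> eux; rewrite esym eux.
    - apply/setP => z; rewrite EA !inE.
      by case: eqVneq => [->|] //=; rewrite uU !orbT.
    - by rewrite cA (cardsD1 u U) uU /=; arith.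
    - by move: cU; rewrite (cardsD1 u U) uU; arith.
    - by move=> x y xS /setD1P[_ yU]; apply: nSU.
    - exact: disjointWr (subsetDl _ _) dSU.
    - by rewrite set_cons disjointsU1 uNS.
    - rewrite set_cons disjointsU1 !inE eqxx /=.
      exact: disjointWr (subsetDl _ _) dpU.
  case: p => [|x p] in up sp EA cA dpS dpU no_next *.
    have : U = set0.
      by apply/setP => u; have := no_next u; rewrite /= andbT inE => ->.
    by move=> U0; move: cA cU; rewrite U0 cards0 /=; arith.
  have xNS : x \notin S.
    by rewrite (disjointFr dpS) // !inE eqxx.
  have xNU : x \notin U.
    by rewrite (disjointFr dpU) // !inE eqxx.
  move: dpS dpU; rewrite set_cons !disjointsU1 => /andP[_ dpS] /andP[_ dpU].
  exists p, (x |: S), U; split; split=> //.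
  - by case/andP: up.
  - exact: path_sorted sp.
  - by rewrite EA set_cons; apply/setP => z; rewrite !inE; do ?case: eqP => //=;
      rewrite ?orbT.
  - by rewrite cA cardsU1 xNS /=; arith.
  - by rewrite cardsU1 xNS; arith.
  - move=> z u /setU1P[->|zS] uU; last exact: nSU.
    by have := no_next u; rewrite /= uU /= => ->.
  - by rewrite disjointsU1 xNU.
  - rewrite disjoint_sym disjointsU1 inE disjoint_sym dpS andbT.
    by case/andP: up.
have [p [S [U [[up sp EA cA cU] H]]]] := main #|A| (leqnn _).
by exists p, S, U; split=> //; split=> //; arith.
Qed.
End DepthFirst.

Lemma link_nth (V : finType) (e : rel V) x0 (p : seq V) a b :
  uniq p -> sorted e p -> a <= b -> b < size p ->
  link e [set x in p] (b - a) (nth x0 p a) (nth x0 p b).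
Proof.
move=> up sp ab bp.
have Ed : nth x0 p a :: drop a.+1 (take b.+1 p) = drop a (take b.+1 p).
  by rewrite (drop_nth x0 (n := a)) ?size_takel // nth_take.
exists (drop a.+1 (take b.+1 p)); split.
- by rewrite Ed drop_uniq // take_uniq.
- by have := drop_sorted a (take_sorted b.+1 sp); rewrite -Ed.
- rewrite -[LHS]/(last x0 (nth x0 p a :: _)) Ed -nth_last nth_drop size_drop.
  rewrite size_takel // (_ : a + (b.+1 - a).-1 = b); last by arith.
  by rewrite nth_take.
- by rewrite size_drop size_takel //; arith.
- move=> z; rewrite Ed inE => /mem_drop; exact: mem_take.
Qed.

Section TwoBicliques.
Variables (V : finType) (e : rel V).
Hypothesis esym : symmetric e.
Implicit Types I J S U : {set V}.

Lemma two_bicliques_one_side I J S U r s :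
  [disjoint I :|: J & S :|: U] -> [disjoint I & J] -> [disjoint S & U] ->
  {in I & J, forall x y, e x y} -> {in S & U, forall x y, e x y} ->
  #|I| = r.+1 -> #|J| = r.+1 -> #|S| = s.+1 -> #|U| = s.+1 ->
  {in S :|: U & I, forall x y, e x y} -> has_cycle e (2 * (r + s).+1 + 1).
Proof.
move=> dd dIJ dSU eIJ eSU cI cJ cS cU eSI.
have [u uS] : exists u, u \in S by apply/card_gt0P; rewrite cS.
have [v vU] : exists v, v \in U by apply/card_gt0P; rewrite cU.
have := link_XY (j := s) esym dSU eSU uS vU.
rewrite cS cU ltnSn => /(_ isT isT) L.
have uE x : x \in I -> e u x by move=> xI; apply: eSI; rewrite ?inE ?uS.
have vE x : x \in I -> e v x by move=> xI; apply: eSI; rewrite ?inE ?vU ?orbT.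
have [x xI] : exists x, x \in I by apply/card_gt0P; rewrite cI.
case: r => [|r] in cI cJ *.
  have := link_cycle2 dd (link1 e (D := I :|: J) (x := x) _) L.
  rewrite !inE xI esym uE ?vE // => /(_ isT isT isT); congr has_cycle.
  arith.
have [y] : exists y, y \in I :\ x.
  by apply/card_gt0P; move: cI; rewrite (cardsD1 x) xI; arith.
rewrite !inE eq_sym => /andP[xy yI].
have := link_XX (j := r) esym dIJ eIJ xI yI xy.
rewrite cI cJ ltnSn ltnW // => /(_ isT isT) L'.
have := link_cycle2 dd L' L; rewrite vE // esym uE // => /(_ isT isT).
congr has_cycle; arith.
Qed.

Lemma two_bicliques_cycle I J S U r s :
  [disjoint I :|: J & S :|: U] -> [disjoint I & J] -> [disjoint S & U] ->
  {in I & J, forall x y, e x y} -> {in S & U, forall x y, e x y} ->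
  #|I| = r.+1 -> #|J| = r.+1 -> #|S| = s.+1 -> #|U| = s.+1 ->
  {in S :|: U, forall w, {in I, forall x, e w x} \/ {in J, forall x, e w x}} ->
  exists2 l, 2 * (r + s).+1 < l & has_cycle e l.
Proof.
move=> dd dIJ dSU eIJ eSU cI cJ cS cU side.
pose full (K : {set V}) w := [forall x in K, e w x].
have fullP (K : {set V}) w : reflect {in K, forall x, e w x} (full K w).
  exact: (iffP forall_inP).
have [/forall_inP allI|] := boolP [forall w in S :|: U, full I w].
  exists (2 * (r + s).+1 + 1); first by rewrite addn1.
  apply: (two_bicliques_one_side dd dIJ dSU) => // w x wSU.
  exact/fullP/allI.
rewrite negb_forall_in => /exists_inP[w wSU nIw].
have [/forall_inP allJ|] := boolP [forall w in S :|: U, full J w].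
  exists (2 * (r + s).+1 + 1); first by rewrite addn1.
  apply: (@two_bicliques_one_side J I S U) => //.
  - by rewrite setUC.
  - by rewrite disjoint_sym.
  - by move=> x y xJ yI; rewrite esym eIJ.
  - by move=> x y xSU; apply/fullP/allJ.
rewrite negb_forall_in => /exists_inP[w' w'SU nJw'].
have Jw : {in J, forall x, e w x} by case: (side _ wSU) => // /fullP; rewrite (negPf nIw).
have Iw' : {in I, forall x, e w' x}.
  by case: (side _ w'SU) => // /fullP; rewrite (negPf nJw').
have ww' : w != w' by apply: contraNneq nIw => ->; apply/fullP.
have [x xI] : exists x, x \in I by apply/card_gt0P; rewrite cI.
have [y yJ] : exists y, y \in J by apply/card_gt0P; rewrite cJ.
have := link_XY (j := r) esym dIJ eIJ xI yJ.
rewrite cI cJ ltnSn => /(_ isT isT) L.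
have [l lge L'] : exists2 l, s.*2 <= l & link e (S :|: U) l w w'.
  have dUS : [disjoint U & S] by rewrite disjoint_sym.
  have eUS : {in U & S, forall x y, e x y} by move=> ? ? ? ?; rewrite esym eSU.
  have two (K : {set V}) : #|K| = s.+1 -> w \in K -> w' \in K -> 0 < s.
    move=> cK wK w'K; move: cK.
    by rewrite (cardsD1 w) wK (cardsD1 w') !inE eq_sym ww' w'K; arith.
  move: wSU w'SU; rewrite !inE => /orP[]wK /orP[]w'K.
  - exists s.-1.*2.+2; first by arith.
    by apply: link_XX => //; rewrite ?cS ?cU; have := two _ cS wK w'K; arith.
  - by exists s.*2.+1 => //; apply: link_XY; rewrite ?cS ?cU.
  - exists s.*2.+1 => //; rewrite setUC; by apply: link_XY; rewrite ?cS ?cU.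
  - exists s.-1.*2.+2; first by arith.
    rewrite setUC; apply: link_XX => //; rewrite ?cS ?cU;
    by have := two _ cU wK w'K; arith.
exists (r.*2.+1 + l).+2; first by arith.
by apply: (link_cycle2 dd L L'); [rewrite esym Jw | rewrite Iw'].
Qed.
End TwoBicliques.

Section LongCycle.
Variables (V : finType) (col : V -> V -> bool).
Hypothesis col_sym : forall x y, col x y = col y x.
Local Notation E b := (fun x y => col x y == b).

Lemma col_symr b : symmetric (E b).
Proof. by move=> x y; rewrite col_sym. Qed.

Lemma long_mono_cycle n : 0 < n -> 4 * n + 1 <= #|V| ->
  exists b, exists2 l, 2 * n < l & has_cycle (E b) l.
Proof.
move=> n0 cV.
have [p [S [U [[up sp EA cA cU] [nSU dSU dpS dpU]]]]] :=
  path_cut (col_symr true) [set: V].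
rewrite cardsT in cA.
have eSU : {in S & U, forall x y, E false x y}.
  by move=> x y xS yU; have := nSU x y xS yU; rewrite eqb_id eqbF_neg.
have [nS|Sn] := ltnP n #|S|.
  have [x xS] : exists x, x \in S by apply/card_gt0P; arith.
  have [y yU] : exists y, y \in U by apply/card_gt0P; arith.
  exists false, n.*2.+2; first by arith.
  apply: link_cycle (link_XY (j := n) (col_symr _) dSU eSU xS yU _ _) _ => //.
    by rewrite cU.
  by rewrite col_sym; apply: eSU.
pose s := #|S|; pose r := n.+1 - s; pose m := size p.
have /card_gt0P[x0 _] : 0 < #|V| by arith.
pose I := [set x in take r p]; pose J := [set x in drop (m - r) p].
have memI x : x \in I -> exists2 a, a < r & x = nth x0 p a.
  rewrite inE => /(nthP x0)[a]; rewrite size_takel; last by rewrite -/m; arith.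
  by move=> ar <-; exists a => //; rewrite nth_take.
have memJ x : x \in J -> exists2 b, m - r <= b < m & x = nth x0 p b.
  rewrite inE => /(nthP x0)[b]; rewrite size_drop -/m => bm <-.
  by exists (m - r + b); [arith | rewrite nth_drop].
have LIJ x y : x \in I -> y \in J ->
    exists2 l, 2 * n <= l & link (E true) [set x in p] l x y.
  move=> /memI[a ar ->] /memJ[b br ->]; exists (b - a); first by arith.
  by apply: link_nth => //; rewrite -?/m; arith.
have [/exists_inP[x xI /exists_inP[y yJ cxy]]|noIJ] :=
    boolP [exists x in I, exists y in J, col x y].
  have [l ln L] := LIJ x y xI yJ.
  exists true, l.+1 => //; apply: link_cycle L _.
  by rewrite col_sym cxy.
have eIJ : {in I & J, forall x y, E false x y}.
  move=> x y xI yJ; apply/eqP/negbTE; apply: contra noIJ => cxy.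
  by apply/exists_inP; exists x => //; apply/exists_inP; exists y.
have [/exists_inP[w wSU /exists_inP[x xI /exists_inP[y yJ /andP[wx wy]]]]|noSU] :=
    boolP [exists w in S :|: U, exists x in I, exists y in J, col w x && col w y].
  have [l ln L] := LIJ x y xI yJ.
  exists true, (l + 0).+2; first by arith.
  apply: (link_cycle2 _ L (link1 _ (set11 w))); last by rewrite wx.
    rewrite disjoint_sym disjoints1; move: wSU; rewrite in_setU.
    by case/orP => [/(disjointFl dpS)->|/(disjointFl dpU)->].
  by rewrite col_sym wy.
have cI : #|I| = r.
  by rewrite cardsE; move/card_uniqP: (take_uniq r up) => ->; rewrite size_takel // -/m; arith.
have cJ : #|J| = r.
  by rewrite cardsE; move/card_uniqP: (drop_uniq (m - r) up) => ->; rewrite size_drop -/m; arith.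
have dIJ : [disjoint I & J].
  apply/pred0P => x /=; apply/negP => /andP[/memI[a ar ->] /memJ[b br]].
  by move/eqP; rewrite nth_uniq // -?/m; arith.
have sIp : I \subset [set x in p] by apply/subsetP => x; rewrite !inE => /mem_take.
have sJp : J \subset [set x in p] by apply/subsetP => x; rewrite !inE => /mem_drop.
have [s0|s_gt0] := posnP s.
  have [x xI] : exists x, x \in I by apply/card_gt0P; arith.
  have [y yJ] : exists y, y \in J by apply/card_gt0P; arith.
  exists false, n.*2.+2; first by arith.
  apply: link_cycle (link_XY (j := n) (col_symr _) dIJ eIJ xI yJ _ _) _; try arith.
  by rewrite col_sym; apply: eIJ.
have d1 : [disjoint I :|: J & S :|: U].
  apply: disjointWl (_ : _ \subset [set x in p]) _; first by rewrite subUset sIp.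
  rewrite -setI_eq0 setIUr setU_eq0 !setI_eq0; exact/andP.
have Er : r = r.-1.+1 by rewrite /r; clear -Sn; arith.
have Es : s = s.-1.+1 by clear -s_gt0; arith.
have side : {in S :|: U, forall w,
    {in I, forall x, E false w x} \/ {in J, forall x, E false w x}}.
  move=> w wSU; have [/forall_inP H|/forall_inPn[x xI cx]] :=
    boolP [forall x in I, E false w x]; first by left.
  right=> y yJ; apply/eqP/negbTE; apply: contra noSU => cy.
  apply/exists_inP; exists w => //; apply/exists_inP; exists x => //.
  apply/exists_inP; exists y => //; rewrite cy andbT.
  by move: cx; rewrite eqbF_neg negbK.
rewrite Er in cI cJ.
have cS : #|S| = s.-1.+1 by rewrite -Es.
have [l ln L] := two_bicliques_cycle (col_symr false) d1 dIJ dSU eIJ eSU cI cJ cS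
  (etrans cU cS) side.
by exists false, l => //; clear -ln Sn s_gt0; arith.
Qed.
End LongCycle.

(** * Shortening monochromatic cycles *)

(* An [e]-cycle of length [L], indexed by the residues modulo [L]. *)
Definition periodic_cycle (V : eqType) (e : rel V) (L : nat) (f : nat -> V) :
    Prop :=
  (forall i, e (f i) (f i.+1)) /\ (forall i j, (f i == f j) = (i == j %[mod L])).

Definition arcset (V : finType) (f : nat -> V) a m : {set V} :=
  [set x in [seq f i | i <- iota a m]].

Section PeriodicCycles.
Variables (V : finType) (e : rel V).
Hypothesis esym : symmetric e.

Lemma periodic_of_cycle L : 0 < L -> has_cycle e L ->
  exists f, periodic_cycle e L f.
Proof.
move=> L0 [[|x t] [us ss cs]]; first by move: L0; rewrite -ss.
subst L; exists (fun i => nth x (x :: t) (i %% size (x :: t))).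
split=> [i|i j]; last by rewrite nth_uniq // ltn_mod.
have : i %% size (x :: t) < size (x :: t) by rewrite ltn_mod.
have -> : i.+1 %% size (x :: t) = (i %% size (x :: t)).+1 %% size (x :: t).
  by rewrite -addn1 -modnDml addn1.
move: (i %% _) => {}i ix.
move/pathP: cs => /(_ x i); rewrite size_rcons => /(_ ix).
rewrite -rcons_cons nth_rcons ix nth_rcons.
have [it|ti] := ltnP i (size t); first by rewrite modn_small.
have -> : i = size t by apply/eqP; rewrite eqn_leq ti -ltnS ix.
by rewrite eqxx modnn.
Qed.

Variables (L : nat) (f : nat -> V).
Hypothesis fL : periodic_cycle e L f.

Lemma periodic_shift t : periodic_cycle e L (fun i => f (i + t)).
Proof.
have [fe fi] := fL; split=> [i|i j]; first by rewrite addSn.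
by rewrite fi eqn_modDr.
Qed.

Lemma periodicD i : f (i + L) = f i.
Proof. by apply/eqP; rewrite fL.2 modnDr. Qed.

Lemma periodic0 : f L = f 0. Proof. exact: periodicD 0. Qed.

Lemma periodic_inj a i j : a <= i < a + L -> a <= j < a + L -> f i = f j -> i = j.
Proof.
move=> /andP[ai iL] /andP[aj jL] /eqP; rewrite fL.2.
rewrite -(subnK ai) -(subnK aj) eqn_modDr !modn_small ?ltn_subLR //.
by move=> /eqP->.
Qed.

Lemma mem_arc a m x : x \in arcset f a m -> exists2 i, a <= i < a + m & x = f i.
Proof. by rewrite inE => /mapP[i]; rewrite mem_iota => ai ->; exists i. Qed.

Lemma arc_disjoint a m b m' : a + m <= b -> b + m' <= a + L ->
  [disjoint arcset f a m & arcset f b m'].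
Proof.
move=> ab ba; apply/pred0P => x; apply/negP => /andP[/mem_arc[i ai ->] /mem_arc[j bj]].
by move/(periodic_inj (a := a)) => H; have := H _ _; arith.
Qed.

Lemma card_arc a m : m <= L -> #|arcset f a m| = m.
Proof.
move=> mL; rewrite cardsE -[RHS](size_iota a) -(size_map f); apply/card_uniqP.
rewrite map_inj_in_uniq ?iota_uniq // => i j.
by rewrite !mem_iota => ai aj; apply: (periodic_inj (a := a)); lia.
Qed.

Lemma link_arc a m : m < L -> link e (arcset f a m.+1) m (f a) (f (a + m)).
Proof.
move=> mL; exists [seq f i | i <- iota a.+1 m]; split.
- rewrite -map_cons -[_ :: _]/(iota a m.+1) map_inj_in_uniq ?iota_uniq //.
  by move=> i j; rewrite !mem_iota => ai aj; apply: (periodic_inj (a := a)); lia.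
- by elim: m a {mL} => //= m IH a; rewrite fL.1 IH.
- by elim: m a {mL} => [|m IH] a /=; rewrite ?addn0 // IH addnS.
- by rewrite size_map size_iota.
- by move=> x xs; rewrite in_set.
Qed.

Lemma cycle_skip : 2 < L -> e (f 0) (f 2) -> has_cycle e L.-1.
Proof.
move=> L2 e02.
have := link_arc (2) (m := L.-2); rewrite (_ : 2 + L.-2 = L); last by lia.
rewrite periodic0 => /(_ ltac:(lia)) Lk.
by have := link_cycle Lk e02; rewrite (_ : L.-2.+1 = L.-1); last by lia.
Qed.

Lemma cycle_cross d : 0 < d -> d + 2 < L ->
  e (f 0) (f d) -> e (f 1) (f (d + 2)) -> has_cycle e L.-1.
Proof.
move=> d0 dL e0d e1d.
have L1 := link_rev esym (link_arc (1) (m := d.-1) ltac:(lia)).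
have L2 := link_arc (d + 2) (m := L - d.+2) ltac:(lia).
rewrite (_ : 1 + d.-1 = d) in L1; last by lia.
rewrite (_ : d + 2 + (L - d.+2) = L) ?periodic0 in L2; last by lia.
have dd : [disjoint arcset f 1 d.-1.+1 & arcset f (d + 2) (L - d.+2).+1].
  by apply: arc_disjoint; lia.
have := link_cycle2 dd L1 L2 e1d e0d.
by rewrite (_ : (d.-1 + (L - d.+2)).+2 = L.-1); last by lia.
Qed.

Lemma cycle_chords4 : 8 < L -> (forall i, e (f i) (f (i + 4))) -> has_cycle e L.-1.
Proof.
move=> L8 e4.
have L1 : link e (arcset f 0 8) 6 (f 0) (f 7).
  exists [seq f i | i <- [:: 4; 5; 6; 2; 3; 7]]; split=> //.
  - rewrite -[f 0 :: _]/([seq f i | i <- [:: 0; 4; 5; 6; 2; 3; 7]]).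
    rewrite map_inj_in_uniq // => i j; rewrite !inE => Hi Hj.
    by apply: (periodic_inj (a := 0)); lia.
  - by rewrite /= (e4 0) !fL.1 (esym (f 6)) (e4 2) (e4 3).
  - move=> x; rewrite -[f 0 :: _]/([seq f i | i <- [:: 0; 4; 5; 6; 2; 3; 7]]) in_set.
    by case/mapP=> i Hi ->; apply: map_f; rewrite mem_iota; move: Hi; rewrite !inE; lia.
have L2 := link_arc (8) (m := L - 9) ltac:(lia).
have dd : [disjoint arcset f 0 8 & arcset f 8 (L - 9).+1] by apply: arc_disjoint; lia.
have := link_cycle2 dd L1 L2 (fL.1 7).
rewrite (_ : 8 + (L - 9) = L.-1); last by lia.
have := fL.1 L.-1; rewrite prednK ?periodic0; last by lia.
by move=> -> /(_ isT); rewrite (_ : (6 + (L - 9)).+2 = L.-1); last by lia.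
Qed.

End PeriodicCycles.

Section Descent.
Variables (V : finType) (col : V -> V -> bool).
Hypothesis col_sym : forall x y, col x y = col y x.
Local Notation E b := (fun x y => col x y == b).

Lemma colN b x y : (col x y == ~~ b) = (col x y != b).
Proof. by case: (col x y); case: b. Qed.

Lemma periodic_odd_double b b' L f : odd L -> periodic_cycle (E b) L f ->
  (forall i, E b' (f i) (f (i + 2))) -> periodic_cycle (E b') L (fun i => f i.*2).
Proof.
move=> oL fL e2; split=> [i|i j].
  by have := e2 i.*2; rewrite addn2.
rewrite fL.2; have half k : L.+1./2 * k.*2 = k %[mod L].
  rewrite -mul2n mulnA muln2 halfK /= oL subn0 mulSn addnC mulnC.
  by rewrite modnMDl.
apply/eqP/eqP => [H|H].
  by rewrite -half -modnMmr H modnMmr half.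
by rewrite -!muln2 -modnMml H modnMml.
Qed.

Lemma periodic_even_double b b' L f t : ~~ odd L -> periodic_cycle (E b) L f ->
  (forall i, E b' (f i) (f (i + 2))) ->
  periodic_cycle (E b') L./2 (fun i => f (i.*2 + t)).
Proof.
move=> eL fL e2; split=> [i|i j].
  by have := e2 (i.*2 + t); rewrite addnAC addn2.
rewrite fL.2 eqn_modDr -!muln2.
by rewrite -{1 2}(even_halfK eL) -muln2 -!muln_modl eqn_pmul2r.
Qed.

Section Minimal.
Variable L : nat.
Hypothesis no_cycle : forall b, ~ has_cycle (E b) L.-1.

Lemma skip_color b f : 2 < L -> periodic_cycle (E b) L f ->
  forall i, E (~~ b) (f i) (f (i + 2)).
Proof.
move=> L2 fL i; rewrite /= colN; apply/negP => H.
apply: (no_cycle (b := b)); apply: (cycle_skip (periodic_shift fL i) L2).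
by rewrite add0n addnC.
Qed.

Lemma odd_cycle_descent b : odd L -> 8 < L -> ~ has_cycle (E b) L.
Proof.
move=> oL L8 /periodic_of_cycle[|f fL]; first by lia.
have L2 : 2 < L by lia.
have chord4 g : periodic_cycle (E b) L g -> E b (g 0) (g 4).
  move=> gL; have := periodic_odd_double oL gL (skip_color L2 gL).
  by move/(skip_color L2)/(_ 0); rewrite negbK.
apply: (no_cycle (b := b)); apply: cycle_chords4 L8 _ => [||i].
- exact: col_symr.
- exact: fL.
- by have := chord4 _ (periodic_shift fL i); rewrite /= add0n (addnC 4).
Qed.

(* A red chord [f 0 -- f d] at even distance makes two edges between the blue
   cycles on even and on odd indices blue, and these splice both blue cycles
   into one that misses only [f d]. *)
Lemma even_chord b d f : 9 < L -> ~~ odd L -> ~~ odd d -> 0 < d < L ->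
  periodic_cycle (E b) L f -> E (~~ b) (f 0) (f d).
Proof.
move=> L9 eL ed /andP[d0 dL] fL; have L2 : 2 < L by lia.
have [-> | d2] := eqVneq d 2; first exact: (skip_color L2 fL 0).
have [Ed | dL2] := eqVneq d L.-2.
  have := skip_color L2 fL L.-2; rewrite (_ : L.-2 + 2 = L); last by lia.
  by rewrite (periodic0 fL) Ed col_sym.
rewrite /= colN; apply/negP => H.
have esym := col_symr col_sym.
have blue1 : E (~~ b) (f 1) (f (d + 2)).
  rewrite /= colN; apply/negP => H1; apply: (no_cycle (b := b)).
  apply: (cycle_cross (esym _) fL (d := d)) => //; by lia.
have blue2 : E (~~ b) (f L.-1) (f (d - 2 + L)).
  rewrite /= colN; apply/negP => H1; apply: (no_cycle (b := b)).
  have fL' := periodic_shift fL L.-1.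
  apply: (cycle_cross (esym _) fL' (d := d.-1)); try lia.
  - rewrite add0n (_ : d.-1 + L.-1 = d - 2 + L); last by lia.
    exact: H1.
  - rewrite (_ : 1 + L.-1 = 0 + L); last by lia.
    rewrite (_ : d.-1 + 2 + L.-1 = d + L); last by lia.
    by rewrite !(periodicD fL).
have dbl t := periodic_even_double t eL fL (skip_color L2 fL).
have even_arc := link_arc (dbl 0) d./2.+1 (m := L./2.-2) ltac:(lia).
have odd_arc := link_rev (esym _) (link_arc (dbl 1) 0 (m := L./2.-1) ltac:(lia)).
case: (no_cycle (b := ~~ b)).
have EL := even_halfK eL; have Ed := even_halfK ed.
rewrite (_ : L.-1 = (L./2.-2 + L./2.-1).+2); last by lia.
apply: (link_cycle2 _ even_arc odd_arc).
- apply/pred0P => x; apply/negP => /andP[/mem_arc[i _ ->] /mem_arc[j _ /eqP]].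
  rewrite fL.2 => /eqP /(congr1 odd).
  by rewrite !odd_mod ?(negbTE eL) // addn0 addn1 /= !odd_double.
- rewrite (_ : (d./2.+1 + L./2.-2).*2 + 0 = d - 2 + L); last by lia.
  rewrite (_ : (0 + L./2.-1).*2 + 1 = L.-1); last by lia.
  by rewrite col_sym.
- by rewrite (_ : d./2.+1.*2 + 0 = d + 2); last by lia.
Qed.

End Minimal.
End Descent.

(** * The two-color case *)

Section Ramsey.
Variables (V : finType) (col : V -> V -> bool).
Hypothesis col_sym : forall x y, col x y = col y x.
Local Notation E b := (fun x y => col x y == b).
Variable n : nat.
Hypothesis no_cycle : forall b, ~ has_cycle (E b) (2 * n + 1).
Let esym b : symmetric (E b) := col_symr col_sym b.

Lemma blue_side b (K O : {set V}) v : 1 < n ->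
  [disjoint K & O] -> n < #|K| -> n < #|O| ->
  {in K & O, forall p q, p != v -> E (~~ b) p q} ->
  (v \in K -> forall q, exists2 q', q' \in O & q' != q /\ E (~~ b) v q') ->
  forall w, w \notin K -> w \notin O ->
  {in K, forall x, E b w x} \/ {in O, forall x, E b w x}.
Proof.
move=> n1 dKO cK cO red redv w wK wO.
have [/forall_inP H|/forall_inPn[p pK wp]] :=
  boolP [forall x in K, E b w x]; first by left.
right=> q qO; apply/negPn/negP => wq.
have wp' : E (~~ b) p w by rewrite /= colN // col_sym.
have wq' : E (~~ b) q w by rewrite /= colN // col_sym.
have dK'O : [disjoint K :\ v & O] by apply: disjointWl (subsetDl _ _) dKO.
have redK : {in K :\ v & O, forall p q, E (~~ b) p q}.
  by move=> x y /setD1P[xv xK] yO; apply: red.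
have cK' : n <= #|K :\ v| by move: cK; rewrite (cardsD1 v); case: (_ \in _); arith.
apply: (no_cycle (b := ~~ b)).
have [pv|pv] := eqVneq p v; last first.
  have pK' : p \in K :\ v by rewrite !inE pv.
  have L := link_XY (j := n.-1) (esym _) dK'O redK pK' qO ltac:(arith) ltac:(arith).
  rewrite (_ : 2 * n + 1 = (0 + n.-1.*2.+1).+2); last by arith.
  apply: (link_cycle2 _ (link1 _ (set11 w)) L) => //; last by rewrite /= col_sym.
  by rewrite disjoints1 !inE negb_or negb_and wK wO orbT.
subst p; have [q' q'O [q'q vq']] := redv pK q.
have eOK : {in O & K :\ v, forall x y, E (~~ b) x y}.
  by move=> x y xO yK; rewrite /= col_sym; apply: redK.
have dOK' : [disjoint O & K :\ v] by rewrite disjoint_sym.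
have L := link_XX (j := n.-2) (esym _) dOK' eOK q'O qO q'q ltac:(arith) ltac:(arith).
have L2 : link (E (~~ b)) [set w; v] 1 w v.
  exists [:: v]; split=> //=; rewrite ?inE ?andbT.
  - by apply: contraNneq wK => ->.
  - by rewrite col_sym.
  - by move=> x; rewrite !inE.
rewrite (_ : 2 * n + 1 = (1 + n.-2.*2.+2).+2); last by arith.
apply: (link_cycle2 _ L2 L) => //.
rewrite disjointsU1 disjoints1 !inE !negb_or (negbTE wK) wO eqxx /= !andbF andbT.
by rewrite (disjointFr dKO pK).
Qed.

Lemma two_cliques b (K O : {set V}) : 1 < n ->
  [disjoint K & O] -> n < #|K| -> n < #|O| ->
  {in K &, forall x y, x != y -> E b x y} ->
  {in O &, forall x y, x != y -> E b x y} ->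
  {in K, forall p q, exists2 q', q' \in O & q' != q /\ E (~~ b) p q'} ->
  {in O, forall q p, exists2 p', p' \in K & p' != p /\ E (~~ b) q p'} ->
  #|V| <= 4 * n.
Proof.
move=> n1 dKO cK cO eK eO redK redO.
have side : forall w, w \notin K -> w \notin O ->
  {in K, forall x, E b w x} \/ {in O, forall x, E b w x}.
  have no_matching p q p' q' : p \in K -> p' \in K -> q \in O -> q' \in O ->
      E b p q -> E b p' q' -> (p == p') || (q == q').
    move=> pK p'K qO q'O pq p'q'; apply/negPn/negP; rewrite negb_or => /andP[pp qq].
    apply: (no_cycle (b := b)).
    have L1 := link_clique (j := n.-1) eK pK p'K pp ltac:(arith).
    have L2 := link_clique (j := n.-2) eO q'O qO ltac:(by rewrite eq_sym) ltac:(arith).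
    rewrite (_ : 2 * n + 1 = (n.-1.+1 + n.-2.+1).+2); last by arith.
    by apply: (link_cycle2 dKO L1 L2) => //=; rewrite col_sym.
  have [/exists_inP[p pK /exists_inP[q qO pq]]|no_blue] :=
      boolP [exists p in K, exists q in O, E b p q]; last first.
    have /card_gt0P[p pK] : 0 < #|K| by arith.
    apply: (blue_side n1 dKO cK cO (v := p)) => [x y xK yO _|]; last exact: redK.
    rewrite /= colN; apply: contra no_blue => xy; apply/exists_inP; exists x => //.
    by apply/exists_inP; exists y.
  have [/exists_inP[p' p'K /andP[p'p /exists_inP[q' q'O p'q']]]|star_p] :=
      boolP [exists p' in K, (p' != p) && [exists q' in O, E b p' q']]; last first.
    apply: (blue_side n1 dKO cK cO (v := p)) => [x y xK yO xp|]; last exact: redK.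
    rewrite /= colN; apply: contra star_p => xy; apply/exists_inP; exists x => //.
    by rewrite xp; apply/exists_inP; exists y.
  have qq' : q = q'.
    by have := no_matching _ _ _ _ pK p'K qO q'O pq p'q'; rewrite eq_sym (negbTE p'p) => /eqP.
  move: p'q'; rewrite -{q' q'O}qq' => p'q w wK wO.
  apply/or_comm; move: w wO wK.
  have dOK : [disjoint O & K] by rewrite disjoint_sym.
  apply: (blue_side n1 dOK cO cK (v := q)) => [y x yO xK yq|]; last exact: redO.
  rewrite /= colN col_sym; apply/negP => xy.
  have := no_matching _ _ _ _ pK xK qO yO pq xy.
  have := no_matching _ _ _ _ p'K xK qO yO p'q xy.
  rewrite (eq_sym q) (negbTE yq) !orbF => /eqP Ep' /eqP Ep.
  by rewrite Ep' Ep eqxx in p'p.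
pose half (K1 K2 : {set V}) := K1 :|:
  [set w | [&& w \notin K1, w \notin K2 & [forall x in K1, E b w x]]].
have half_small (K1 K2 : {set V}) : n < #|K1| ->
    {in K1 &, forall x y, x != y -> E b x y} -> #|half K1 K2| <= 2 * n.
  move=> cK1 eK1; rewrite leqNgt -addn1; apply/negP => H; apply: (no_cycle (b := b)).
  apply: (clique_join_cycle (esym b) _ (K := K1) (W := half K1 K2)) => //.
  - exact: ltnW.
  - exact: subsetUl.
  - move=> x w xK1; rewrite !inE => /orP[|/and3P[_ _ /forall_inP H1 _]]; first exact: eK1.
    by rewrite /= col_sym; apply: H1.
have cover : [set: V] \subset half K O :|: half O K.
  apply/subsetP => w _; rewrite !inE.
  case wK: (w \in K) => //=; case wO: (w \in O); rewrite ?orbT //=.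
  have [H|H] := side w (negbT wK) (negbT wO); apply/orP; [left | right];
  exact/forall_inP.
rewrite -cardsT; apply: leq_trans (subset_leq_card cover) _.
rewrite cardsU; apply: leq_trans (leq_subr _ _) _.
by have := half_small _ O cK eK; have := half_small _ K cO eO; arith.
Qed.

Lemma ramsey_odd_cycle : 3 < n -> #|V| <= 4 * n.
Proof.
move=> n3; rewrite leqNgt -addn1; apply/negP => cV.
have no_long l : 2 * n + 1 <= l -> forall b, ~ has_cycle (E b) l.
  elim: l => [|l IH] nl; first by arith.
  have [<-|nl'] := eqVneq (2 * n + 1) l.+1; first exact: no_cycle.
  have {}IH := IH ltac:(lia); have L8 : 8 < l.+1 by arith.
  have [ol|el] := boolP (odd l.+1).
    by move=> b; apply: (odd_cycle_descent col_sym (L := l.+1) IH ol L8).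
  move=> b /periodic_of_cycle[//|f fL]; set L := l.+1 in fL el L8.
  have L9 : 9 < L by rewrite ltn_neqAle L8 andbT; apply: contraNneq el => <-.
  have L2 : 2 < L by arith.
  have nk : n < L./2 by rewrite /L; lia.
  have chord := even_chord col_sym (L := l.+1) IH L9 el.
  pose D t := arcset (fun i => f (i.*2 + t)) 0 L./2.
  have dbl t := periodic_even_double t el fL (skip_color (L := l.+1) IH L2 fL).
  have memD t j : t <= 1 -> odd j = odd t -> f j \in D t.
    move=> t1 ojt; have EL := even_halfK el.
    have jL : j %% L < L by rewrite ltn_mod.
    have jt : (j %% L)./2.*2 + t = j %% L.
      rewrite -[RHS]odd_double_half odd_mod ?(negbTE el) // ojt addnC.
      by congr (_ + _); case: (t) t1 => [|[]].
    rewrite inE; apply/mapP; exists ((j %% L)./2).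
      by rewrite mem_iota /=; clear -jL EL; lia.
    by apply/eqP; rewrite fL.2 jt modn_mod.
  have Dcl t : {in D t &, forall x y, x != y -> E (~~ b) x y}.
    have lt_chord i j : i < j < L./2 -> E (~~ b) (f (i.*2 + t)) (f (j.*2 + t)).
      move=> /andP[ij jL].
      have := chord _ (j - i).*2 _ _ _ (periodic_shift fL (i.*2 + t)).
      rewrite odd_double add0n addnA -doubleD subnK ?(ltnW ij) //; apply => //.
      by have := even_halfK el; lia.
    move=> x y /mem_arc[i iL ->] /mem_arc[j jL ->].
    have [ij|ji|->] := ltngtP i j; last by rewrite eqxx.
      by move=> _; apply: lt_chord; lia.
    by move=> _; rewrite /= col_sym; apply: lt_chord; lia.
  have red t p q : t <= 1 -> p \in D t -> exists2 q', q' \in D (1 - t) & q' != q /\ E b p q'.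
    move=> t1 /mem_arc[i _ ->]; set j := i.*2 + t.
    have D1 : f j.+1 \in D (1 - t).
      by apply: memD; rewrite ?leq_subr // /= /j oddD odd_double; case: (t) t1 => [|[]].
    have D2 : f (j + l) \in D (1 - t).
      apply: memD; rewrite ?leq_subr // !oddD odd_double.
      by move: el; rewrite /= negbK => ->; case: (t) t1 => [|[]].
    have [Eq|] := eqVneq (f j.+1) q; last by exists (f j.+1) => //; split=> //; apply: fL.1.
    exists (f (j + l)) => //; split; last first.
      rewrite /= col_sym -(periodicD fL j) addnS; exact: fL.1.
    rewrite -Eq fL.2 -addn1 eqn_modDl !modn_small //; last by arith.
    by apply/eqP; clear -L8; lia.
  have D01 : [disjoint D 0 & D 1].
    apply/pred0P => x; apply/negP => /andP[/mem_arc[i _ ->] /mem_arc[j _ /eqP]].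
    rewrite fL.2 => /eqP /(congr1 odd).
    by rewrite !odd_mod ?(negbTE el) // addn0 addn1 /= !odd_double.
  have cD t : n < #|D t| by rewrite (card_arc (dbl t)).
  suff : #|V| <= 4 * n by rewrite leqNgt -addn1 cV.
  apply: (two_cliques (b := ~~ b) (ltnW (ltnW n3)) D01 (cD 0) (cD 1)) => //.
    by move=> p pD q; rewrite negbK; apply: (red 0).
  by move=> p pD q; rewrite negbK; apply: (red 1).
have [|b [l nl]] := long_mono_cycle col_sym (n := n) _ cV; first by arith.
by apply: no_long; rewrite addn1.
Qed.

End Ramsey.

(** * Gallai partitions *)

Section GallaiPartition.
Variables (V T : finType) (c : V -> V -> T).
Hypothesis c_sym : forall x y, c x y = c y x.
Hypothesis gallai : forall x y z, x != y -> y != z -> x != z ->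
  [|| c x y == c y z, c y z == c x z | c x y == c x z].
Implicit Types (A : {set V}) (S : {set T}).

Lemma connect_ind (r : rel V) (P : pred V) x y :
  (forall u w, P u -> r u w -> P w) -> P x -> connect r x y -> P y.
Proof.
move=> Pr Px /connectP[p rp ->]; elim: p x Px rp => //= z p IH x Px /andP[xz].
exact: IH (Pr _ _ Px xz).
Qed.

Definition other_color (a b : T) A : rel V := fun u w =>
  [&& u \in A, w \in A, u != w & c u w \notin [:: a; b]].

(* The parts of the Gallai partition of [A] with reduced colors [a] and [b] are
   the components of the graph formed by all other colors. *)
Definition same_part (a b : T) A : rel V := connect (other_color a b A).

Lemma other_color_sym a b A : symmetric (other_color a b A).
Proof. by move=> x y; rewrite /other_color andbCA eq_sym c_sym. Qed.

Lemma same_part_refl a b A x : same_part a b A x x.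
Proof. exact: connect0. Qed.

Lemma same_part_sym a b A x y : same_part a b A x y = same_part a b A y x.
Proof. exact/sym_connect_sym/other_color_sym. Qed.

Lemma same_part_trans a b A x y z :
  same_part a b A x y -> same_part a b A y z -> same_part a b A x z.
Proof. exact: connect_trans. Qed.

Lemma reduced_color a b A x y : x \in A -> y \in A -> ~~ same_part a b A x y ->
  c x y \in [:: a; b].
Proof.
move=> xA yA nxy; have xy : x != y by apply: contraNneq nxy => ->; exact: connect0.
by apply: contraR nxy => cxy; apply/connect1/and4P.
Qed.

Lemma same_part_color a b A x x' y : x \in A -> y \in A -> same_part a b A x x' ->
  ~~ same_part a b A x y -> c x y = c x' y.
Proof.
move=> xA yA xx' nxy.
pose P u := [&& u \in A, c u y == c x y & ~~ same_part a b A u y].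
suff /and3P[_ /eqP-> _] : P x' by [].
apply: (@connect_ind _ P) xx' => [u w /and3P[uA /eqP Eu nuy] ruw|]; last exact/and3P.
have [_ wA uw cuw] := and4P ruw.
have nwy : ~~ same_part a b A w y.
  by apply: contra nuy => wy; apply: same_part_trans wy; apply: connect1.
apply/and3P; split=> //; rewrite -Eu.
have cuy := reduced_color uA yA nuy; have cwy := reduced_color wA yA nwy.
have uy : u != y by apply: contraNneq nuy => ->; apply: same_part_refl.
have wy : w != y by apply: contraNneq nwy => ->; apply: same_part_refl.
case/or3P: (gallai uw wy uy) => /eqP E; last by rewrite E cuy in cuw.
  by rewrite E cwy in cuw.
by rewrite E.
Qed.

Lemma gallai_partition A S : 1 < #|A| -> 1 < #|S| ->
  {in A &, forall x y, x != y -> c x y \in S} ->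
  exists a b x y, [/\ a \in S, b \in S, a != b, x \in A & y \in A /\
    ~~ same_part a b A x y].
Proof.
move=> A1 S1; have [m] := ubnP #|A|; elim: m A A1 => // m IH A A1 Am AS.
have isolated v w a b : v != w ->
    {in A, forall z, z != v -> c v z \in [:: a; b]} -> ~~ same_part a b A v w.
  move=> vw cv; apply/negP => /(@connect_ind _ (pred1 v)) H.
  have /eqP E : pred1 v w; last by rewrite E eqxx in vw.
  apply: H => [u z /eqP-> /and4P[_ zA vz /negP]|]; last exact: eqxx.
  by case; apply: cv; rewrite // eq_sym.
have [v vA] : exists v, v \in A by apply/card_gt0P; apply: ltnW.
pose A' := A :\ v; have cA' : #|A| = #|A'|.+1 by rewrite (cardsD1 v) vA.
have sA' : {subset A' <= A} by move=> z /setD1P[].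
have vA' z : z \in A' -> v != z by rewrite !inE eq_sym => /andP[].
have [A'1|A'1] := leqP #|A'| 1.
  have /card_gt0P[w wA'] : 0 < #|A'| by arith.
  have aS := AS _ _ vA (sA' _ wA') (vA' _ wA').
  have /card_gt0P[b] : 0 < #|S :\ c v w| by move: S1; rewrite (cardsD1 (c v w)) aS.
  rewrite !inE eq_sym => /andP[ab bS].
  exists (c v w), b, v, w; split=> //; split; first exact: sA'.
  apply: isolated (vA' _ wA') _ => z zA zv.
  rewrite inE; apply/orP; left; apply/eqP; congr (c v _).
  by apply: (card_le1_eqP A'1) => //; rewrite !inE zv.
have [|||a [b [x0 [y0 [aS bS ab x0A [y0A n0]]]]]] := IH A' _ _ _; try by arith.
  by move=> x y /sA' xA /sA' yA; apply: AS.
pose far z := c v z \notin [:: a; b].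
have [/forall_inP meets|/forall_inPn[x xA' /exists_inPn noz]] :=
    boolP [forall x in A', exists z in A', same_part a b A' x z && far z]; last first.
  exists a, b, x, v; split=> //; first exact: sA'.
  split=> //; apply/negP => /(@connect_ind _ (same_part a b A' x)) H.
  have /(@connect_ind _ (mem A')) : same_part a b A' x v.
    apply: H => [u w xu|]; last exact: same_part_refl.
    have uA' : u \in A' by apply: connect_ind xu => // y z _ /and4P[].
    case/and4P => uA wA uw cuw; have [wv|wv] := eqVneq w v.
      by have := noz _ uA'; rewrite xu /far c_sym -wv cuw.
    apply: same_part_trans xu (connect1 _); apply/and4P; split=> //.
    by rewrite !inE wv.
  by move=> H2; have /vA'/eqP : v \in A' by apply: H2 => // u w _ /and4P[].
have /exists_inP[z0 z0A /andP[xz0 fz0]] := meets _ x0A.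
have /exists_inP[z1 z1A /andP[yz1 fz1]] := meets _ y0A.
have far_eq z z' : z \in A' -> z' \in A' -> far z -> far z' ->
    ~~ same_part a b A' z z' -> c v z = c v z'.
  move=> zA z'A fz fz' nz; have czz' := reduced_color zA z'A nz.
  have zz' : z != z' by apply: contraNneq nz => ->; apply: same_part_refl.
  case/or3P: (gallai (vA' _ zA) zz' (vA' _ z'A)) => /eqP //.
    by move=> E; rewrite /far E czz' in fz.
  by move=> E; rewrite /far -E czz' in fz'.
have nz01 : ~~ same_part a b A' z0 z1.
  apply: contra n0 => zz; apply: same_part_trans xz0 _; apply: same_part_trans zz _.
  by rewrite same_part_sym.
set d := c v z0.
have far_d z : z \in A' -> far z -> c v z = d.
  move=> zA fz; have [zz0|] := boolP (same_part a b A' z z0); last exact: far_eq.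
  rewrite /d (far_eq z0 z1) //; apply: far_eq => //; apply: contra nz01.
  by apply: same_part_trans; rewrite same_part_sym.
have dS : d \in S by apply: AS (vA' _ z0A) => //; apply: sA'.
have meets_d x : x \in A' -> exists2 z, z \in A' & same_part a b A' x z /\ c v z = d.
  move=> /meets /exists_inP[z zA /andP[xz fz]]; exists z => //.
  by split=> //; apply: far_d.
(* An edge of reduced color from [v] forces the same color on all edges
   leaving its part, so [v] cannot send out both reduced colors. *)
have forced x e y : x \in A' -> y \in A' -> e \in [:: a; b] -> c v x = e ->
    ~~ same_part a b A' x y -> c x y = e.
  move=> xA yA eab vx nxy; have [z zA [yz vz]] := meets_d y yA.
  have nxz : ~~ same_part a b A' x z.
    apply: contra nxy => xz; apply: same_part_trans xz _.
    by rewrite same_part_sym.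
  have -> : c x y = c x z.
    rewrite c_sym [RHS]c_sym; apply: (same_part_color yA xA yz).
    by rewrite same_part_sym.
  have xz : x != z by apply: contraNneq nxz => ->; apply: same_part_refl.
  have cxz := reduced_color xA zA nxz.
  have nd : d \notin [:: a; b] by [].
  case/or3P: (gallai (vA' _ xA) xz (vA' _ zA)) => /eqP E.
  - by rewrite -E.
  - by rewrite E vz (negbTE nd) in cxz.
  - by rewrite -vz -E vx eab in nd.
have avoid e e' : e \in S -> e' \in [:: a; b] -> [:: a; b] =i [:: e; e'] ->
    {in A', forall x, c v x != e'} ->
    exists a b x y, [/\ a \in S, b \in S, a != b, x \in A & y \in A /\
      ~~ same_part a b A x y].
  move=> eS e'ab Eab ne'; exists e, d, v, z0; split=> //.
  - by apply: contraTneq fz0 => Ed; rewrite /far -/d -Ed Eab !inE eqxx.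
  - split; first exact: sA'.
    apply: isolated (vA' _ z0A) _ => z zA zv.
    have zA' : z \in A' by rewrite !inE zv.
    have [fz|] := boolP (far z); first by rewrite far_d // !inE eqxx orbT.
    by rewrite negbK Eab !inE (negbTE (ne' _ zA')) orbF => ->.
have [/forall_inP na|/forall_inPn[x xA]] := boolP [forall x in A', c v x != a].
  by apply: (avoid b a) => // [|z]; rewrite ?inE ?eqxx // orbC.
rewrite negbK => /eqP vx.
apply: (avoid a b) => // [|y yA]; first by rewrite !inE eqxx orbT.
apply/eqP => vy; case/eqP: ab.
have aab : a \in [:: a; b] by rewrite !inE eqxx.
have bab : b \in [:: a; b] by rewrite !inE eqxx orbT.
have [xy|nxy] := boolP (same_part a b A' x y); last first.
  rewrite -(forced x a y) // c_sym; apply: forced => //.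
  by rewrite same_part_sym.
have [z zA nxz] : exists2 z, z \in A' & ~~ same_part a b A' x z.
  have [xz0'|] := boolP (same_part a b A' x z0); last by exists z0.
  exists z1 => //; apply: contra nz01; apply: same_part_trans.
  by rewrite same_part_sym.
rewrite -(forced x a z) // (same_part_color xA zA xy nxz).
apply: forced => //; apply: contra nxz; exact: same_part_trans.
Qed.

End GallaiPartition.

(** * Linear forests and sparse colors *)

Section BicliqueCycles.
Variables (V : finType) (e : rel V) (n : nat) (X Y : {set V}).
Hypotheses (esym : symmetric e) (dXY : [disjoint X & Y]).
Hypothesis eXY : {in X & Y, forall x y, e x y}.

Lemma inner_edge_cycle u v : 0 < n -> n < #|X| -> n <= #|Y| ->
  u \in X -> v \in X -> u != v -> e u v -> has_cycle e (2 * n + 1).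
Proof.
move=> n0 cX cY uX vX uv euv.
have L := link_XX (j := n.-1) esym dXY eXY uX vX uv ltac:(arith) ltac:(arith).
have := link_cycle L; rewrite esym => /(_ euv).
by rewrite (_ : n.-1.*2.+3 = 2 * n + 1); last by arith.
Qed.

Lemma apex_cycle w x y : 0 < n -> n <= #|X| -> n <= #|Y| -> w \notin X :|: Y ->
  x \in X -> y \in Y -> e w x -> e w y -> has_cycle e (2 * n + 1).
Proof.
move=> n0 cX cY wXY xX yY wx wy.
have L := link_XY (j := n.-1) esym dXY eXY xX yY ltac:(arith) ltac:(arith).
have d1 : [disjoint [set w] & X :|: Y] by rewrite disjoints1.
have := link_cycle2 d1 (link1 e (set11 w)) L wx; rewrite esym => /(_ wy).
by rewrite (_ : (0 + n.-1.*2.+1).+2 = 2 * n + 1); last by arith.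
Qed.

Lemma outer_edge_cycle u v x x' : 1 < n -> n <= #|X| -> n <= #|Y|.+1 ->
  u \notin X :|: Y -> v \notin X :|: Y -> u != v -> e u v ->
  x \in X -> x' \in X -> x != x' -> e u x -> e v x' -> has_cycle e (2 * n + 1).
Proof.
move=> n1 cX cY uXY vXY uv euv xX x'X xx' ux vx'.
have L := link_XX (j := n.-2) esym dXY eXY xX x'X xx' ltac:(arith) ltac:(arith).
have L2 : link e [set v; u] 1 v u.
  exists [:: u]; split=> //=; rewrite ?inE ?andbT 1?eq_sym //; first by rewrite esym.
  by move=> z; rewrite !inE.
have d1 : [disjoint [set v; u] & X :|: Y].
  by rewrite disjointsU1 disjoints1 vXY uXY.
have := link_cycle2 d1 L2 L ux; rewrite esym => /(_ vx').
by rewrite (_ : (1 + n.-2.*2.+2).+2 = 2 * n + 1); last by arith.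
Qed.

End BicliqueCycles.

(* Single vertices count as paths, so the number [t] of paths is exact. *)
Definition linear_forest (V : finType) (e : rel V) (R : {set V}) (t f : nat) :
    Prop :=
  exists ss : seq (seq V),
  [/\ size ss = t, all (fun q => (q != [::]) && sorted e q) ss,
      uniq (flatten ss), {subset flatten ss <= R} & size (flatten ss) = f].

Section Forests.
Variables (V : finType) (e : rel V).
Hypothesis esym : symmetric e.

Lemma forest_cycle (T R : {set V}) t f : 0 < t -> #|T| = t ->
  [disjoint T & R] -> {in T & R, forall x y, e x y} ->
  linear_forest e R t f -> has_cycle e (t + f).
Proof.
move=> t0 cT dTR eTR [ss [st ass uss ssR sf]].
pose weave (ts : seq V) qs := flatten [seq p.1 :: p.2 | p <- zip ts qs].
have weave_perm ts qs : size ts = size qs ->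
    perm_eq (weave ts qs) (ts ++ flatten qs).
  elim: qs ts => [|q qs IH] [|x ts] //= [/IH]; rewrite /weave /= => H.
  by rewrite perm_cons perm_sym perm_catCA perm_cat2l perm_sym.
have weave_path a ts qs : size ts = size qs -> {subset ts <= T} ->
    all (fun q => (q != [::]) && sorted e q) qs -> {subset flatten qs <= R} ->
    {in T, forall x, e a x} -> path e a (weave ts qs).
  elim: qs a ts => [|q qs IH] a [|x ts] //= [szt] tsT /andP[/andP[]].
  case: q => // y q _ /= py aqs qsR ea.
  have xT : x \in T by apply: tsT; rewrite mem_head.
  have yqR z : z \in y :: q -> z \in R.
    by move=> zq; apply: qsR; rewrite /= -cat_cons mem_cat zq.
  rewrite /weave /= -/(weave ts qs) ea //= cat_path eTR ?yqR ?mem_head //= py /=.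
  apply: IH => // [z zt|z zq|z zT]; first by apply: tsT; rewrite inE zt orbT.
    by apply: qsR; rewrite /= -cat_cons mem_cat zq orbT.
  by rewrite esym eTR // yqR // mem_last.
have szT : size (enum T) = size ss by rewrite -cardE cT st.
have mT : {subset enum T <= T} by move=> z; rewrite mem_enum.
have P := weave_perm _ _ szT.
exists (weave (enum T) ss); split.
- rewrite (perm_uniq P) cat_uniq enum_uniq uss andbT; apply/hasPn => z /ssR zR.
  by rewrite mem_enum (disjointFl dTR zR).
- by rewrite (perm_size P) size_cat sf szT st.
case Ew : (weave (enum T) ss) => [|x w] //.
have xw : last x w \in R.
  case/lastP: ss Ew szT ass ssR {st uss sf P} => [|ss q].
    by move=> _ szT; move: t0; rewrite -cT cardE szT.
  case/lastP: (enum T) mT => [|ts z] // mT Ew; first by rewrite size_rcons.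
  rewrite !size_rcons => -[szt]; rewrite all_rcons => /andP[/andP[q0 _] _] ssR.
  move: Ew; rewrite /weave zip_rcons // map_rcons flatten_rcons => Ew.
  apply: ssR; rewrite flatten_rcons mem_cat; apply/orP; right.
  rewrite -[last x w]/(last x (x :: w)) -Ew last_cat.
  by case: q q0 {Ew} => //= y q _; apply: mem_last.
rewrite cycle_last andbC -[e _ _ && _]/(path e (last x w) (x :: w)) -Ew.
by apply: weave_path => // z zT; rewrite esym eTR.
Qed.

Lemma path_forest (R : {set V}) t (p : seq V) : 0 < t -> t <= size p ->
  uniq p -> sorted e p -> {subset p <= R} -> linear_forest e R t (size p).
Proof.
move=> t0 tp up sp pR.
exists (rcons [seq [:: x] | x <- take t.-1 p] (drop t.-1 p)).
have E : flatten (rcons [seq [:: x] | x <- take t.-1 p] (drop t.-1 p)) = p.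
  rewrite flatten_rcons -[RHS](cat_take_drop t.-1); congr (_ ++ _).
  exact: flatten_seq1.
split; rewrite ?E //.
- by rewrite size_rcons size_map size_takel; arith.
- rewrite all_rcons drop_sorted // andbT -size_eq0 size_drop.
  apply/andP; split; first by rewrite -lt0n subn_gt0 prednK.
  by apply/allP => q /mapP[x _ ->].
Qed.

End Forests.

Lemma card_red_setD1 (V : finType) (r : rel V) (Y : {set V}) x :
  #|[set y in Y | (y != x) && r x y]| <= #|[set y in Y :\ x | r x y]|.
Proof.
by apply/subset_leq_card/subsetP => y; rewrite !inE => /and3P[-> -> ->].
Qed.

(* Delete vertices of degree at least [n - 1] one at a time. Among the last
   [2n - 2] vertices, two such vertices share a neighbor and have a further
   neighbor each, which gives a path on five vertices. *)
Lemma prune_high_degree (V : finType) (red : rel V) (Z : {set V}) n :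
  symmetric red -> 3 < n -> 2 * n <= #|Z| ->
  (forall q, sorted red q -> uniq q -> all (mem Z) q -> size q = 5 -> False) ->
  exists Y : {set V}, [/\ Y \subset Z, 2 * n <= #|Y| + 3 &
    {in Y, forall x, #|[set y in Y | (y != x) && red x y]| + 2 <= n}].
Proof.
move=> red_sym n4 cZ noP5.
have [|Z0 [_ Z0Z cZ0]] := card_between (sub0set Z) _ cZ; first by rewrite cards0.
pose good (Y : {set V}) :=
  [forall x in Y, #|[set y in Y | (y != x) && red x y]| + 2 <= n].
have step (Y : {set V}) : ~~ good Y -> exists2 x, x \in Y &
    #|Y :\ x|.+1 = #|Y| /\ n <= #|[set y in Y :\ x | red x y]|.+1.
  case/forall_inPn => x xY; rewrite -ltnNge addn2 ltnS => H; exists x => //.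
  split; first by rewrite (cardsD1 x Y) xY.
  by apply: leq_trans H _; rewrite ltnS card_red_setD1.
have [g0|/step[x1 x1Y [c1 _]]] := boolP (good Z0).
  by exists Z0; split=> //; [arith | apply/forall_inP].
have D1 : Z0 :\ x1 \subset Z := subset_trans (subsetDl _ _) Z0Z.
have [g1|/step[x2 x2Y [c2 _]]] := boolP (good (Z0 :\ x1)).
  by exists (Z0 :\ x1); split=> //; [arith | apply/forall_inP].
have D2 : Z0 :\ x1 :\ x2 \subset Z := subset_trans (subsetDl _ _) D1.
have [g2|/step[x3 x3Y [c3 n3]]] := boolP (good (Z0 :\ x1 :\ x2)).
  by exists (Z0 :\ x1 :\ x2); split=> //; [arith | apply/forall_inP].
have D3 : Z0 :\ x1 :\ x2 :\ x3 \subset Z := subset_trans (subsetDl _ _) D2.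
have [g3|/step[x4 x4Y [c4 n4']]] := boolP (good (Z0 :\ x1 :\ x2 :\ x3)).
  by exists (Z0 :\ x1 :\ x2 :\ x3); split=> //; [arith | apply/forall_inP].
set Y2 := Z0 :\ x1 :\ x2 in x3Y D2 c2 c3 n3 D3 x4Y c4 n4'.
set Y3 := Y2 :\ x3 in c3 n3 D3 x4Y c4 n4'; set Y4 := Y3 :\ x4 in c4 n4'.
pose N3 := [set y in Y4 | red x3 y]; pose N4 := [set y in Y4 | red x4 y].
have cN4 : n <= #|N4|.+1 by [].
have cN3 : n <= #|N3|.+2.
  apply: leq_trans n3 _; rewrite ltnS (cardsD1 x4) -add1n leq_add ?leq_b1 //.
  by apply/subset_leq_card/subsetP => y; rewrite !inE => /and3P[-> -> ->].
have [z zN] : exists z, z \in N3 :&: N4.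
  apply/card_gt0P; rewrite cardsI.
  have : #|N3 :|: N4| <= #|Y4|.
    by apply/subset_leq_card/subsetP => y; rewrite !inE => /orP[]/andP[].
  by arith.
have [zN3 zN4] := setIP zN.
have /card_gt0P[z3] : 0 < #|N3 :\ z| by move: cN3; rewrite (cardsD1 z) zN3; arith.
case/setD1P=> z3z z3N.
have /card_gt0P[z4] : 0 < #|N4 :\ z :\ z3|.
  move: cN4; rewrite (cardsD1 z) zN4 (cardsD1 z3 (_ :\ _)).
  by case: (z3 \in _); arith.
case/setD1P=> z4z3 /setD1P[z4z z4N].
have [[zY r3z] [_ r4z]] := (setIdP zN3, setIdP zN4).
have [[z3Y r33] [z4Y r44]] := (setIdP z3N, setIdP z4N).
have Y4Y3 y : y \in Y4 -> y \in Y3 by case/setD1P.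
have Y4Z y : y \in Y4 -> y \in Z by move/Y4Y3; apply: (subsetP D3).
have nx3 y : y \in Y3 -> y != x3 by case/setD1P.
have nx4 y : y \in Y4 -> y != x4 by case/setD1P.
exfalso; apply: (noP5 [:: z3; x3; z; x4; z4]) => //=.
- by rewrite red_sym r33 r3z red_sym r4z r44.
- have y3 y : y \in Y3 -> x3 != y by rewrite eq_sym; apply: nx3.
  have y4 y : y \in Y4 -> x4 != y by rewrite eq_sym; apply: nx4.
  have zz4 : z != z4 by rewrite eq_sym.
  have z34 : z3 != z4 by rewrite eq_sym.
  rewrite !in_cons !in_nil !orbF !negb_or z3z z34 zz4 (y3 x4) //.
  by rewrite !y3 ?Y4Y3 // nx3 ?Y4Y3 // !nx4 // y4.
- by rewrite (Y4Z z3) // (Y4Z z) // (Y4Z z4) // (subsetP D2) // (subsetP D3).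
Qed.

Lemma uniq_flatten_mem (T : eqType) (ss : seq (seq T)) q :
  uniq (flatten ss) -> q \in ss -> uniq q.
Proof.
elim: ss => //= r ss IH; rewrite cat_uniq inE => /and3P[ur _ uss].
by case/orP=> [/eqP->|/IH->].
Qed.

Section SparseRed.
Variables (V : finType) (red blue part : rel V) (T R : {set V}) (n m t : nat).
Hypotheses (red_sym : symmetric red) (blue_sym : symmetric blue).
Hypothesis part_refl : reflexive part.
Hypothesis two_colored :
  {in R &, forall x y, ~~ part x y -> red x y || blue x y}.
Hypothesis part_small : {in R, forall x, #|[set y in R | part x y]| <= m}.
Hypotheses (m_gt1 : 1 < m) (mt : m <= t) (tn : t < n) (n4 : 3 < n) (n5 : n <= 5).
Hypotheses (cT : #|T| = t) (dTR : [disjoint T & R]).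
Hypothesis TR_red : {in T & R, forall x y, red x y}.
Hypothesis cR : 7 * n + 4 <= 2 * (#|R| + t).
Hypotheses (no_red : ~ has_cycle red (2 * n + 1)).
Hypotheses (no_blue : ~ has_cycle blue (2 * n + 1)).

Lemma few_red_neighbors (W : {set V}) : W \subset R -> 2 * n + 1 <= #|W| ->
  {in W, forall x, #|[set y in W | (y != x) && red x y]| + m <= n} -> False.
Proof.
move=> WR cW redW; apply: no_blue; apply: (Dirac_sub blue_sym cW) => x xW.
have xR := subsetP WR x xW.
apply: leq_trans (redW x xW); rewrite addnC.
apply: leq_trans (leq_add (part_small xR) (leqnn _)).
apply: leq_trans (leq_card_setU _ _); apply/subset_leq_card/subsetP => y.
rewrite !inE => /andP[yW H]; rewrite yW (subsetP WR y yW) /=.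
have [->|yx] := eqVneq y x; first by rewrite part_refl.
move: H; rewrite (negbTE yx) /=; have [//|npxy] := boolP (part x y).
by have := two_colored xR (subsetP WR y yW) npxy; case: (red x y) => //= ->.
Qed.

Section Extremal.
Variables (ss : seq (seq V)) (f : nat).
Hypotheses (sz : size ss = t) (uss : uniq (flatten ss)) (sf : size (flatten ss) = f).
Hypothesis ass : all (fun q => (q != [::]) && sorted red q) ss.
Hypothesis ssR : {subset flatten ss <= R}.
Hypothesis ft : f + t <= 2 * n.
Hypothesis fmax : ~ linear_forest red R t f.+1.
Let Z := R :\: [set x in flatten ss].

(* Otherwise [q'] could replace [q] in the forest. *)
Lemma no_longer_path (q q' : seq V) : q \in ss -> sorted red q' -> uniq q' ->
  {subset q' <= [predU q & Z]} -> size q' = (size q).+1 -> False.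
Proof.
move=> qss sq' uq' q'Z sq.
have P := perm_to_rem qss; set rs := rem q ss in P.
have Pf : perm_eq (flatten ss) (q ++ flatten rs) by exact: (perm_flatten P).
apply: fmax; exists (q' :: rs); split.
- by rewrite /= -sz (perm_size P).
- by move: ass; rewrite (perm_all _ P) /= => /andP[_ ->]; rewrite sq' -size_eq0 sq.
- move: uss; rewrite (perm_uniq Pf) /= !cat_uniq uq' => /and3P[_ /hasPn dq ->].
  rewrite andbT; apply/hasPn => x xr; apply/negP => /q'Z; rewrite inE /=.
  case/orP=> [xq|]; first by have /negP := dq x xr; apply.
  by rewrite !inE (perm_mem Pf) mem_cat xr orbT.
- move=> x; rewrite /= mem_cat => /orP[/q'Z|xr].
    case/orP=> /= [xq|]; last by rewrite inE => /andP[].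
    by apply: ssR; rewrite (perm_mem Pf) mem_cat xq.
  by apply: ssR; rewrite (perm_mem Pf) mem_cat xr orbT.
- by rewrite /= size_cat sq -sf (perm_size Pf) size_cat addSn.
Qed.

Lemma ZR x : x \in Z -> x \in R. Proof. by rewrite inE => /andP[]. Qed.

Lemma cZ : 2 * n <= #|Z|.
Proof.
rewrite cardsD (setIidPr _); last by apply/subsetP => x; rewrite inE; apply: ssR.
have -> : #|[set x in flatten ss]| = f by rewrite cardsE -sf; apply/card_uniqP.
by arith.
Qed.

Lemma no_longer_path_off (q q' : seq V) : q \in ss -> sorted red q' ->
  uniq q' -> all (mem Z) q' -> size q' = (size q).+1 -> False.
Proof.
move=> qss sq' uq' /allP q'Z; apply: no_longer_path => // x /q'Z /= xZ.
by rewrite inE /= xZ orbT.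
Qed.

Lemma head_not_red x s z : x :: s \in ss -> z \in Z -> ~~ red x z.
Proof.
move=> qss zZ; apply/negP => xz.
have /allP/(_ _ qss)/= sq := ass.
have zq : z \notin x :: s.
  move: zZ; rewrite !inE => /andP[H _]; apply: contra H => zq.
  by apply/flattenP; exists (x :: s).
have uq := uniq_flatten_mem uss qss.
apply: (no_longer_path (q := x :: s) (q' := z :: x :: s)) => //.
- by rewrite /= red_sym xz.
- by rewrite cons_uniq zq.
- move=> y; rewrite inE => /orP[/eqP->|yq]; rewrite inE /=; first by rewrite zZ orbT.
  by rewrite yq.
Qed.

Lemma last_not_red x s z : x :: s \in ss -> z \in Z -> ~~ red (last x s) z.
Proof.
move=> qss zZ; apply/negP => xz.
have /allP/(_ _ qss)/= sq := ass.
have zq : z \notin x :: s.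
  move: zZ; rewrite !inE => /andP[H _]; apply: contra H => zq.
  by apply/flattenP; exists (x :: s).
have uq := uniq_flatten_mem uss qss.
apply: (no_longer_path (q := x :: s) (q' := rcons (x :: s) z)) => //.
- by rewrite /= rcons_path sq xz.
- by rewrite rcons_uniq zq.
- move=> y; rewrite mem_rcons inE => /orP[/eqP->|yq]; rewrite inE /=; first by rewrite zZ orbT.
  by rewrite yq.
- by rewrite size_rcons.
Qed.

Lemma no_singleton x : [:: x] \in ss -> False.
Proof.
move=> xss.
have xNZ : x \notin Z.
  by rewrite !inE negb_and negbK; apply/orP; left; apply/flattenP; exists [:: x] => //; apply: mem_head.
have xR : x \in R by apply: ssR; apply/flattenP; exists [:: x] => //; apply: mem_head.
apply: (@few_red_neighbors (x |: Z)).
- by apply/subsetP => y /setU1P[->|/ZR].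
- by rewrite cardsU1 xNZ; have := cZ; arith.
move=> y yW; rewrite (_ : [set _ in _ | _] = set0) ?cards0; first by arith.
apply/setP => z; rewrite in_set0; apply/negP => /setIdP[zW /andP[zy yz]].
have nx w : w \in Z -> ~~ red x w := head_not_red xss.
case/setU1P: yW yz zy => [->|yZ] yz zy; case/setU1P: zW yz zy => [->|zZ] yz.
- by rewrite eqxx.
- by rewrite (negbTE (nx _ zZ)) in yz.
- by rewrite red_sym (negbTE (nx _ yZ)) in yz.
move=> zy; apply: (no_longer_path_off xss (q' := [:: y; z])) => //=.
- by rewrite yz.
- by rewrite mem_seq1 eq_sym zy.
- by rewrite yZ zZ.
Qed.

Lemma no_edge x y : 2 < t -> [:: x; y] \in ss -> False.
Proof.
move=> t3 xss.
have xin : x \in flatten ss by apply/flattenP; exists [:: x; y] => //; apply: mem_head.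
have xNZ : x \notin Z by rewrite inE in_set xin.
apply: (@few_red_neighbors (x |: Z)).
- by apply/subsetP => z /setU1P[->|/ZR//]; apply: ssR.
- by rewrite cardsU1 xNZ; have := cZ; arith.
move=> z zW; apply: (@leq_trans (1 + m)); last by arith.
rewrite leq_add2r leqNgt; apply/negP => /card_gt1P[w [w' []]].
move=> /setIdP[wW /andP[wz zw]] /setIdP[w'W /andP[w'z zw']] ww'.
have nx u : u \in Z -> ~~ red x u := head_not_red xss.
have inZ u v : u \in x |: Z -> v \in x |: Z -> v != u -> red u v -> u \in Z.
  case/setU1P=> [->|//] /setU1P[->|vZ]; first by rewrite eqxx.
  by rewrite (negbTE (nx _ vZ)).
have zZ := inZ _ _ zW wW wz zw.
have wZ : w \in Z by apply: inZ zW _ _; rewrite // 1?eq_sym // red_sym.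
have w'Z : w' \in Z by apply: inZ zW _ _; rewrite // 1?eq_sym // red_sym.
apply: (no_longer_path_off xss (q' := [:: w; z; w'])) => //=.
- by rewrite red_sym zw zw'.
- by rewrite !in_cons !orbF negb_or wz ww' eq_sym w'z.
- by rewrite wZ zZ w'Z.
Qed.

Lemma no_merge q1 q2 q' : ss = [:: q1; q2] -> sorted red q' ->
  perm_eq q' (q1 ++ q2) -> False.
Proof.
move=> Ess sq' Pq'.
have /card_gt0P[z zZ] : 0 < #|Z| by have := cZ; arith.
have Ef : flatten ss = q1 ++ q2 by rewrite Ess /= cats0.
have q'0 : q' != [::].
  apply: contraTneq ass => q'0; rewrite Ess; case: (q1) Pq' => //= a l.
  by rewrite q'0 perm_sym => /perm_nilP.
apply: fmax; exists [:: q'; [:: z]]; split=> //=.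
- by rewrite -sz Ess.
- by rewrite q'0 sq'.
- rewrite cats1 rcons_uniq (perm_mem Pq') (perm_uniq Pq') -Ef uss andbT.
  by move: zZ; rewrite inE in_set => /andP[].
- move=> x; rewrite cats1 mem_rcons in_cons (perm_mem Pq') -Ef.
  by case/orP => [/eqP->|/ssR//]; apply: ZR.
- by rewrite cats1 size_rcons (perm_size Pq') -Ef sf.
Qed.

Lemma no_two_paths q1 q2 : t = 2 -> ss = [:: q1; q2] -> False.
Proof.
move=> t2 Ess.
have ineq : (q1 \in ss) * (q2 \in ss) by rewrite Ess !in_cons !eqxx orbT.
have : all (fun q => (q != [::]) && sorted red q) [:: q1; q2] by rewrite -Ess.
case: q1 q2 Ess ineq => [|x1 s1] [|x2 s2] Ess [in1 in2]; rewrite /= ?andbF //.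
rewrite andbT => /andP[p1 p2].
have us : uniq ((x1 :: s1) ++ (x2 :: s2)) by move: uss; rewrite Ess [flatten _]/= cats0.
have [ns1 ns2] : s1 != [::] /\ s2 != [::].
  split; apply/eqP => E; first by apply: (@no_singleton x1); have := in1; rewrite E.
  by apply: (@no_singleton x2); have := in2; rewrite E.
set y1 := last x1 s1; set y2 := last x2 s2.
have y1s : y1 \in s1 by rewrite /y1; case: (s1) ns1 => //= a l _; apply: mem_last.
have y2s : y2 \in s2 by rewrite /y2; case: (s2) ns2 => //= a l _; apply: mem_last.
have cross a b : a \in [:: x1; y1] -> b \in [:: x2; y2] -> ~~ red a b.
  have srev (x : V) s : path red x s -> sorted red (rev (x :: s)).
    by rewrite (rev_sorted red) => p; rewrite -(eq_sorted (e := red)) // => u v.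
  have lrev (x y : V) s : last y (rev (x :: s)) = x by rewrite rev_cons last_rcons.
  have glue p y q : p != [::] -> sorted red p -> path red y q ->
      red (last x1 p) y -> sorted red (p ++ y :: q).
    by case: p => //= z p _ pp pq zy; rewrite cat_path /= pp zy.
  rewrite !in_cons !in_nil !orbF => /orP[]/eqP-> /orP[]/eqP->; apply/negP => ab.
  - apply: (no_merge (q' := rev (x1 :: s1) ++ x2 :: s2) Ess); last first.
      by rewrite perm_cat2r perm_rev.
    apply: glue => //; rewrite ?srev ?lrev //.
    by rewrite -size_eq0 size_rev.
  - apply: (no_merge (q' := x2 :: s2 ++ x1 :: s1) Ess); last first.
      by rewrite -cat_cons perm_catC.
    by rewrite /= cat_path p2 /= -/y2 red_sym ab.
  - apply: (no_merge (q' := x1 :: s1 ++ x2 :: s2) Ess); last by [].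
    by rewrite /= cat_path p1 /= -/y1 ab.
  - case Er: (rev (x2 :: s2)) => [|c r].
      by have := size_rev (x2 :: s2); rewrite Er.
    have pr := srev _ _ p2; rewrite Er in pr.
    apply: (no_merge (q' := (x1 :: s1) ++ rev (x2 :: s2)) Ess); last first.
      by rewrite perm_cat2l perm_rev.
    rewrite Er; apply: glue => //.
    have E2 : x2 :: s2 = rcons (rev r) c by rewrite -rev_cons -Er revK.
    have <- : y2 = c by rewrite -[y2]/(last x2 (x2 :: s2)) E2 last_rcons.
    exact: ab.
have noP5 q : sorted red q -> uniq q -> all (mem Z) q -> size q = 5 -> False.
  move=> sq uq qZ cq.
  have [p pss [sp0 sp]] : exists2 p, p \in ss & 0 < size p /\ size p <= 4.
    have : size (x1 :: s1) + size (x2 :: s2) = f.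
      by rewrite -sf Ess /= cats0 size_cat.
    have [small|] := leqP (size (x1 :: s1)) 4; first by exists (x1 :: s1); rewrite ?in1.
    move=> big sz12; exists (x2 :: s2); rewrite ?in2 //; split=> //.
    rewrite -(leq_add2l (size (x1 :: s1))) sz12; apply: (@leq_trans 8); first by arith.
    by rewrite (leq_add2r 4 4); apply: ltnW.
  apply: (no_longer_path_off pss (q' := take (size p).+1 q)).
  - exact: take_sorted.
  - exact: take_uniq.
  - by apply/allP => x /mem_take; apply: (allP qZ).
  - by rewrite size_takel // cq.
have [Y [YZ cY lowY]] := prune_high_degree red_sym n4 cZ noP5.
have m2 : m = 2 by arith.
pose ends := [:: x1; y1; x2; y2].
have endsF x : x \in ends -> x \in flatten ss.
  rewrite Ess !in_cons !in_nil orbF /= cats0 !(in_cons, mem_cat).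
  by case/or4P => /eqP->; rewrite ?eqxx ?y1s ?y2s ?orbT.
have endsNZ x : x \in ends -> x \notin Z by move=> /endsF xF; rewrite inE in_set xF.
have ends_red x z : x \in ends -> z \in Z -> ~~ red x z.
  rewrite !in_cons !in_nil orbF => /or4P[]/eqP-> zZ.
  - exact: head_not_red in1 zZ.
  - exact: last_not_red in1 zZ.
  - exact: head_not_red in2 zZ.
  - exact: last_not_red in2 zZ.
apply: (@few_red_neighbors (Y :|: [set x in ends])).
- rewrite subUset (subset_trans YZ (subsetDl _ _)) /=.
  by apply/subsetP => x; rewrite inE => /endsF/ssR.
- have dYE : Y :&: [set x in ends] = set0.
    apply/setP => x; rewrite in_set0 in_setI in_set; apply/negP => /andP[xY /endsNZ].
    by rewrite (subsetP YZ).
  have uends : uniq ends.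
    move: us; rewrite cat_uniq => /and3P[/andP[x1s _] /hasPn d12 /andP[x2s _]].
    have neq a b : a \in x1 :: s1 -> b \in x2 :: s2 -> a != b.
      by move=> a1 /d12; apply: contraNneq => <-.
    have [a1 a2] : x1 \in x1 :: s1 /\ y1 \in x1 :: s1.
      by rewrite mem_head in_cons y1s orbT.
    have [b1 b2] : x2 \in x2 :: s2 /\ y2 \in x2 :: s2.
      by rewrite mem_head in_cons y2s orbT.
    have xy1 : x1 != y1 by apply: contraNneq x1s => ->.
    have xy2 : x2 != y2 by apply: contraNneq x2s => ->.
    by rewrite /ends /= !in_cons !in_nil !orbF !negb_or xy1 xy2 !neq.
  have cE : #|[set x in ends]| = 4 by rewrite cardsE; apply/card_uniqP.
  by rewrite cardsU dYE cards0 subn0 cE; arith.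
move=> w; case/setUP => [wY|].
  apply: leq_trans (lowY w wY); rewrite m2 leq_add2r.
  apply/subset_leq_card/subsetP => z /setIdP[zW /andP[zw wz]].
  rewrite inE zw wz !andbT; case/setUP: zW => //; rewrite inE => zE.
  by have := ends_red z w zE (subsetP YZ _ wY); rewrite red_sym wz.
rewrite inE => wE.
have [p Hp] : exists p, {in ends, forall z, z != w -> red w z -> z = p}.
  have cross' a b : a \in [:: x1; y1] -> b \in [:: x2; y2] -> ~~ red b a.
    by rewrite red_sym; apply: cross.
  have [i11 i12] : x1 \in [:: x1; y1] /\ y1 \in [:: x1; y1].
    by rewrite !inE !eqxx orbT.
  have [i21 i22] : x2 \in [:: x2; y2] /\ y2 \in [:: x2; y2].
    by rewrite !inE !eqxx orbT.
  move: wE; rewrite !in_cons !in_nil orbF => /or4P[]/eqP->;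
  [exists y1 | exists x1 | exists y2 | exists x2] => z;
  rewrite !in_cons !in_nil orbF => /or4P[]/eqP->; rewrite ?eqxx //;
  by move=> _; apply: contraTeq => _; first [exact: cross | exact: cross'].
apply: (@leq_trans (#|[set p]| + m)); last by rewrite cards1; arith.
rewrite leq_add2r; apply/subset_leq_card/subsetP => z /setIdP[zW /andP[zw wz]].
rewrite in_set1; case/setUP: zW => [zY|].
  by have := ends_red w z wE (subsetP YZ _ zY); rewrite wz.
by rewrite inE => zE; apply/eqP/Hp.
Qed.

Lemma extremal_forest : False.
Proof.
have [t2|t2] := eqVneq t 2.
  case: ss sz no_two_paths => [|q1 [|q2 [|q3 r]]] /=; rewrite t2 // => _ H.
  exact: H q1 q2 erefl erefl.
have t3 : 2 < t by lia.
have [/hasP[q qss qs]|/hasPn big] := boolP (has (fun q => size q <= 2) ss).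
  have /allP/(_ _ qss)/andP[q0 _] := ass.
  case: q q0 qs qss => [|x [|y [|z r]]] // _ _.
    exact: no_singleton.
  exact: no_edge.
have : 3 * size ss <= size (flatten ss).
  rewrite size_flatten /shape; elim: (ss) big => //= q r IH big.
  have := big q (mem_head _ _); rewrite -ltnNge => q3.
  rewrite mulnS leq_add //; apply: IH => p pr; apply: big.
  by rewrite inE pr orbT.
by rewrite sf sz; arith.
Qed.

End Extremal.

Lemma sparse_red : False.
Proof.
have step f : t <= f -> f <= 2 * n + 1 - t -> ~ ~ linear_forest red R t f.
  elim: f => [|f IH] tf fn; first by arith.
  have [Et|tf'] := eqVneq t f.+1.
    rewrite -Et; apply; exists [seq [:: x] | x <- take t (enum R)].
    have tR : t <= size (enum R) by rewrite -cardE; arith.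
    rewrite flatten_seq1 size_map size_takel // take_uniq ?enum_uniq //; split=> //.
    - by apply/allP => q /mapP[x _ ->].
    - by move=> x /mem_take; rewrite mem_enum.
  have {}IH := IH ltac:(lia) ltac:(lia); move=> nf; apply: IH => -[ss [sz ass uss ssR sf]].
  by apply: (extremal_forest sz uss sf ass ssR _ nf); lia.
apply: (step (2 * n + 1 - t)); try arith; move=> lf.
apply: no_red; rewrite (_ : 2 * n + 1 = t + (2 * n + 1 - t)); last by arith.
by apply: (forest_cycle red_sym _ cT dTR TR_red lf); arith.
Qed.
End SparseRed.

(** * Two colors with attached vertices *)

Lemma sub_cycle_uniq (V : eqType) (e e' : rel V) (s : seq V) :
  uniq s -> 1 < size s ->
  {in s &, forall x y, x != y -> e x y -> e' x y} -> cycle e s -> cycle e' s.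
Proof.
case: s => // x s us s1 ee; rewrite !cycle_last => /andP[ps ls].
apply/andP; split; last first.
  apply: (ee) ls; rewrite ?mem_head ?mem_last //.
  case/lastP: s us s1 {ps ee} => // s y /= /andP[xs _] _.
  by rewrite last_rcons; apply: contraNneq xs => <-; rewrite mem_rcons mem_head.
elim: s x us ee ps {s1 ls} => //= y s IH x /andP[xys uys] ee /andP[exy pys].
apply/andP; split.
  apply: (ee) exy; rewrite ?inE ?eqxx ?orbT //.
  by apply: contraNneq xys => ->; rewrite mem_head.
apply: IH => // u v us vs; apply: ee; by rewrite inE ?us ?vs orbT.
Qed.

Section MainBound.
Variables (V T : finType) (c : V -> V -> T) (n : nat).
Hypothesis c_sym : forall x y, c x y = c y x.
Local Notation E i := (fun x y => c x y == i).
Hypothesis n4 : 3 < n.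
Hypothesis no_cycle : forall i, ~ has_cycle (E i) (2 * n + 1).
Implicit Types (A X Y W : {set V}).

Let Esym i : symmetric (E i).
Proof. by move=> x y; rewrite c_sym. Qed.

Let n1 : 1 < n. Proof. exact: ltn_trans n4. Qed.

Lemma inner_edge i X Y : [disjoint X & Y] -> {in X & Y, forall x y, c x y = i} ->
  n < #|X| -> n <= #|Y| -> {in X &, forall u v, u != v -> c u v != i}.
Proof.
move=> dXY cXY nX nY u v uX vX uv; apply/negP => cuv; apply: (no_cycle (i := i)).
apply: (inner_edge_cycle (Esym i) dXY _ (ltnW n1) nX nY uX vX uv cuv).
by move=> x y xX yY; rewrite /= cXY.
Qed.

Section TwoColors.
Variables (r b : T) (A : {set V}).
Hypothesis colA : {in A &, forall x y, x != y -> (c x y == r) || (c x y == b)}.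

Lemma two_colors_one X : #|X| < n -> [disjoint X & A] ->
  {in X & A, forall x a, c x a = r} -> #|A| + #|X| <= 4 * n.
Proof.
move=> Xn dXA cXA; pose B := A :|: X.
have <- : #|B| = #|A| + #|X|.
  by rewrite cardsU disjoint_setI0 ?cards0 ?subn0 // disjoint_sym.
pose sT := {x | x \in B}.
(* The inside of [X] is recolored blue: no long blue cycle can use it. *)
pose col (x y : sT) := (c (val x) (val y) == r) && ~~ ((val x \in X) && (val y \in X)).
have col_sym x y : col x y = col y x by rewrite /col c_sym (andbC (val x \in X)).
rewrite -(card_sig (mem B)); apply: (ramsey_odd_cycle col_sym) n4 => d.
case=> s [us ss cs].
have uvs : uniq (map val s) by rewrite map_inj_uniq //; apply: val_inj.
case: d cs => cs.
  apply: (no_cycle (i := r)); exists (map val s); split; rewrite ?size_map //.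
  rewrite cycle_map; apply: sub_cycle cs => x y /=.
  by rewrite eqb_id => /andP[].
have [/hasP[x xs xX]|/hasPn noX] := boolP (has (fun x => val x \in X) s).
  have [i s' Es] := rot_to xs.
  have : path (fun x y => col x y == false) x s'.
    by move: cs; rewrite -(rot_cycle i) Es cycle_last => /andP[].
  have sX : {subset x :: s' <= [pred y | val y \in X]} -> False.
    move=> H; have : size (map val (rot i s)) <= #|X|.
      rewrite cardE; apply: uniq_leq_size => [|y /mapP[z]].
        by rewrite map_inj_uniq ?rot_uniq //; apply: val_inj.
      by rewrite Es => /H zX ->; rewrite mem_enum.
    by rewrite size_map size_rot ss; arith.
  move=> ps; apply: sX; elim: s' x xX ps {Es xs} => [|y s' IH] x xX.
    by move=> _ z; rewrite mem_seq1 => /eqP->.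
  case/andP=> xy /IH H z; rewrite in_cons => /orP[/eqP->//|]; apply: H.
  have : val y \in B := valP y.
  rewrite inE => /orP[yA|//]; move: xy.
  by rewrite /col cXA // eqxx xX (disjointFl dXA yA).
apply: (no_cycle (i := b)); exists (map val s); split; rewrite ?size_map //.
rewrite cycle_map; apply: (sub_cycle_uniq us _ _ cs); first by rewrite ss; arith.
move=> x y xs ys xy; rewrite /= eqbF_neg /col (negbTE (noX x xs)) andbT => nr.
have inA z : z \in s -> val z \in A.
  by move=> zs; have : val z \in B := valP z; rewrite inE (negbTE (noX z zs)) orbF.
by have := colA (inA _ xs) (inA _ ys) xy; rewrite (negbTE nr).
Qed.

Lemma two_colors_both X Y : 0 < #|X| < n -> 0 < #|Y| < n ->
  [disjoint X & A] -> [disjoint Y & A] ->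
  {in X & A, forall x a, c x a = r} -> {in Y & A, forall y a, c y a = b} ->
  #|A| + #|X| + #|Y| <= 4 * n.
Proof.
move=> /andP[X0 Xn] /andP[Y0 Yn] dXA dYA cXA cYA.
rewrite leqNgt; apply/negP => cA.
have [p [S [U [[up sp EA cpA cU] [nSU dSU dpS dpU]]]]] := path_cut (Esym r) A.
have [long|short] := leqP (2 * n + 1 - #|X|) (size p).
  pose q := take (2 * n + 1 - #|X|) p.
  have sq : size q = 2 * n + 1 - #|X| by rewrite size_takel.
  have F : linear_forest (E r) A #|X| (size q).
    apply: path_forest => //; rewrite ?sq ?take_uniq //; first by arith.
      exact: take_sorted.
    by move=> x /mem_take xp; rewrite EA !inE xp.
  apply: (no_cycle (i := r)); rewrite (_ : 2 * n + 1 = #|X| + size q); last by rewrite sq; arith.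
  apply: (forest_cycle (Esym r) X0 erefl dXA _ F).
  by move=> x a xX aA; rewrite /= cXA.
have SA : S \subset A by rewrite EA; apply/subsetP => x; rewrite !inE => ->; rewrite orbT.
have UA : U \subset A by rewrite EA; apply/subsetP => x; rewrite !inE => ->; rewrite orbT.
pose k := minn n #|S|.
have [|S' [_ S'S cS']] := card_between (sub0set S) _ (geq_minr n #|S|); first by rewrite cards0.
have kU : k <= #|U| by rewrite cU geq_minr.
have [|U' [_ U'U cU']] := card_between (sub0set U) _ kU; first by rewrite cards0.
have blue x y : x \in S' -> y \in U' -> c x y = b.
  move=> /(subsetP S'S) xS /(subsetP U'U) yU; apply/eqP.
  have xy : x != y by apply: contraTneq xS => ->; rewrite (disjointFl dSU yU).
  have := colA (subsetP SA _ xS) (subsetP UA _ yU) xy.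
  by rewrite (negbTE (nSU x y xS yU)).
have S'A := subset_trans S'S SA; have U'A := subset_trans U'U UA.
apply: (no_cycle (i := b)); apply: (Dirac_sub (Esym b) (W := S' :|: U' :|: Y)).
  have d1 : [disjoint S' & U'] := disjointWl S'S (disjointWr U'U dSU).
  have d2 : [disjoint S' :|: U' & Y].
    by rewrite disjoint_sym; apply: disjointWr dYA; rewrite subUset S'A.
  rewrite cardsU disjoint_setI0 // cardsU disjoint_setI0 // !cards0 !subn0.
  by rewrite cS' cU' /k /minn; case: ifP; arith.
have kn : k <= n by exact: geq_minl.
move=> x; rewrite 2!in_setU => /orP[/orP[xS|xU]|xY].
- apply: leq_trans (_ : #|S'| <= n); last by rewrite cS'.
  apply/subset_leq_card/subsetP => y /setIdP[]; rewrite 2!in_setU.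
  case/orP=> [/orP[//|yU]|yY]; case/orP=> [/eqP->//|]; first by rewrite blue ?eqxx.
  by rewrite c_sym cYA ?eqxx // (subsetP S'A).
- apply: leq_trans (_ : #|U'| <= n); last by rewrite cU'.
  apply/subset_leq_card/subsetP => y /setIdP[]; rewrite 2!in_setU.
  case/orP=> [/orP[yS|//]|yY]; case/orP=> [/eqP->//|]; first by rewrite c_sym blue ?eqxx.
  by rewrite c_sym cYA ?eqxx // (subsetP U'A).
- apply: leq_trans (ltnW Yn); apply/subset_leq_card/subsetP => y /setIdP[].
  have yA z : z \in S' :|: U' -> z \in A.
    by case/setUP => [/(subsetP S'A)|/(subsetP U'A)].
  rewrite in_setU => /orP[/yA yA'|//] /orP[/eqP->//|]; by rewrite cYA ?eqxx.
Qed.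

End TwoColors.

Lemma two_colors (cl : bool -> T) A (X : bool -> {set V}) :
  {in A &, forall x y, x != y -> exists d, c x y = cl d} ->
  (forall d, #|X d| < n) -> (forall d, [disjoint X d & A]) ->
  (forall d, {in X d & A, forall x a, c x a = cl d}) ->
  #|A| + #|X true| + #|X false| <= 4 * n.
Proof.
move=> colA Xn dXA cXA.
have colA1 : {in A &, forall x y, x != y -> (c x y == cl true) || (c x y == cl false)}.
  by move=> x y xA yA /(colA _ _ xA yA)[[] ->]; rewrite eqxx ?orbT.
have colA2 : {in A &, forall x y, x != y -> (c x y == cl false) || (c x y == cl true)}.
  by move=> x y xA yA xy; rewrite orbC colA1.
have [X1|X1] := posnP #|X true|.
  rewrite X1 addn0.
  exact: (two_colors_one colA2 (Xn _) (dXA _) (@cXA _)).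
have [X2|X2] := posnP #|X false|.
  rewrite X2 addn0.
  exact: (two_colors_one colA1 (Xn _) (dXA _) (@cXA _)).
apply: (two_colors_both colA1 _ _ (dXA _) (dXA _) (@cXA _) (@cXA _));
by rewrite Xn ?X1 ?X2.
Qed.
End MainBound.

(** * The reduced coloring *)

Lemma neq_negb (a b : bool) : a != b -> a = ~~ b.
Proof. by case: a b => -[]. Qed.

Section ReducedStep.
Variables (V T : finType) (c : V -> V -> T) (n : nat).
Hypothesis c_sym : forall x y, c x y = c y x.
Local Notation E i := (fun x y => c x y == i).
Hypotheses (n4 : 3 < n) (n5 : n <= 5).
Hypothesis no_cycle : forall i, ~ has_cycle (E i) (2 * n + 1).
Implicit Types (B D Y Z W : {set V}) (x y z v : V) (d : bool).

Variables (A : {set V}) (X : bool -> {set V}) (cl : bool -> T) (part : rel V).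
Variables (x0 y0 : V) (u w : nat).
Hypothesis cl_neq : forall d, cl d != cl (~~ d).
Hypothesis part_refl : reflexive part.
Hypothesis part_sym : symmetric part.
Hypothesis part_trans : transitive part.
Hypothesis part_color : forall x x' y, x \in A -> y \in A -> part x x' ->
  ~~ part x y -> c x y = c x' y.
Hypothesis reduced : forall x y, x \in A -> y \in A -> ~~ part x y ->
  exists d, c x y = cl d.
Hypotheses (x0A : x0 \in A) (y0A : y0 \in A) (nxy0 : ~~ part x0 y0).
Hypothesis Xn : forall d, #|X d| < n.
Hypothesis dXA : forall d, [disjoint X d & A].
Hypothesis cXA : forall d, {in X d & A, forall x a, c x a = cl d}.

Definition avoids (i : T) B := {in B &, forall x y, x != y -> c x y != i}.

(* What the induction hypothesis gives for proper subsets of [A] that lose two,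
   one or none of the reduced colors; [w] accounts for the sets attached in
   the other colors. *)
Hypotheses (nu : 2 * n <= u) (wu : 7 * n + 1 + w <= 4 * u).
Hypothesis bound2 : forall B, B \proper A -> (forall d, avoids (cl d) B) ->
  #|B| + w <= u.
Hypothesis bound1 : forall d B Y, B \proper A -> avoids (cl d) B -> #|Y| < n ->
  [disjoint Y & B] -> {in Y & B, forall x a, c x a = cl (~~ d)} ->
  #|B| + #|Y| + w <= 2 * u.
Hypothesis bound0 : forall B (Y : bool -> {set V}), B \proper A ->
  (forall d, #|Y d| < n) -> (forall d, [disjoint Y d & B]) ->
  (forall d, {in Y d & B, forall x a, c x a = cl d}) ->
  #|B| + #|Y true| + #|Y false| + w <= 4 * u.

Let Esym i : symmetric (E i).
Proof. by move=> x y; rewrite c_sym. Qed.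

Let n1 : 1 < n. Proof. exact: ltn_trans n4. Qed.
Let n0 : 0 < n. Proof. exact: ltn_trans n4. Qed.

Let P x := [set y in A | part x y].
Let large x := n < #|P x|.

Lemma part_sub x : P x \subset A.
Proof. by apply/subsetP => y /setIdP[]. Qed.

Lemma part_self x : x \in A -> x \in P x.
Proof. by move=> xA; rewrite inE xA part_refl. Qed.

Lemma not_part x y z : ~~ part x y -> z \in P x -> ~~ part z y.
Proof. by move=> nxy /setIdP[_ xz]; apply: contra nxy; apply: part_trans. Qed.

Lemma part_disjoint x y : ~~ part x y -> [disjoint P x & P y].
Proof.
move=> nxy; apply/pred0P => z; apply/negP => /andP[/= xz /setIdP[_ yz]].
by have := not_part nxy xz; rewrite part_sym yz.
Qed.

Lemma part_proper x : P x \proper A.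
Proof.
rewrite properE part_sub; apply/subsetPn.
have [x0x|nx0x] := boolP (part x x0).
  exists y0 => //; rewrite inE y0A; apply: contra nxy0 => xy0.
  by apply: part_trans xy0; rewrite part_sym.
by exists x0 => //; rewrite inE x0A.
Qed.

Lemma color_from_part x y z : x \in A -> y \in A -> ~~ part x y -> z \in P x ->
  c y z = c y x.
Proof.
move=> xA yA nxy /setIdP[_ xz].
by rewrite c_sym -(part_color xA yA xz nxy) c_sym.
Qed.

Lemma parts_complete x y : x \in A -> y \in A -> ~~ part x y ->
  {in P x & P y, forall z t, c z t = c x y}.
Proof.
move=> xA yA nxy z t zx ty.
have nyz : ~~ part y z by rewrite part_sym (not_part nxy).
rewrite (color_from_part yA _ nyz ty) ?(subsetP (part_sub x)) //.
by rewrite c_sym; rewrite (color_from_part xA yA nxy zx) c_sym.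
Qed.

Lemma color_cases x y : x \in A -> y \in A -> ~~ part x y -> forall d,
  (c x y != cl d) = (c x y == cl (~~ d)).
Proof.
move=> xA yA nxy d; have [d' ->] := reduced xA yA nxy.
have [->|] := eqVneq d' d; first by rewrite eqxx (negbTE (cl_neq d)).
move=> /neq_negb ->; rewrite eqxx; have := cl_neq (~~ d); rewrite negbK; exact.
Qed.

Lemma inner_edgeE i Y Z : [disjoint Y & Z] -> {in Y & Z, forall x y, c x y = i} ->
  n < #|Y| -> n <= #|Z| -> avoids i Y.
Proof. exact: (inner_edge c_sym n4 no_cycle). Qed.

Lemma part_avoids x y i : x \in A -> y \in A -> ~~ part x y -> large x ->
  large y -> c x y = i -> avoids i (P x).
Proof.
move=> xA yA nxy lx ly <-.
exact: inner_edgeE (part_disjoint nxy) (parts_complete xA yA nxy) lx (ltnW ly).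
Qed.

Lemma no_apex v x y i : x \in A -> y \in A -> ~~ part x y -> large x -> large y ->
  v \notin P x -> v \notin P y -> c x y = i -> c v x = i -> c v y = i -> False.
Proof.
move=> xA yA nxy lx ly vx vy cxy cvx cvy; apply: (no_cycle (i := i)).
apply: (apex_cycle (Esym i) (part_disjoint nxy) _ n0 (ltnW lx) (ltnW ly) (w := v)
  _ (part_self xA) (part_self yA)); rewrite /= ?cvx ?cvy ?eqxx //.
  by move=> z t zx ty; rewrite /= (parts_complete xA yA nxy) // cxy.
by rewrite in_setU negb_or vx.
Qed.

Lemma no_attached d x y : x \in A -> y \in A -> ~~ part x y -> large x ->
  large y -> c x y = cl d -> X d = set0.
Proof.
move=> xA yA nxy lx ly cxy; apply/eqP; rewrite -subset0; apply/subsetP => v vX.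
have vNA : v \notin A by rewrite (disjointFr (dXA d) vX).
have vP z : v \notin P z by apply: contra vNA; apply: (subsetP (part_sub z)).
by case: (no_apex xA yA nxy lx ly (vP x) (vP y) cxy); apply: cXA.
Qed.

(* Parts of size at most [n] joined in a single color leave room for at most
   [2n] vertices, by Dirac. *)
Lemma small_parts_bound d D : D \subset A -> {in D, forall x, ~~ large x} ->
  avoids (cl d) D -> #|D| <= 2 * n.
Proof.
move=> DA small avD; rewrite leqNgt -addn1; apply/negP => cD.
have {}cD : 2 * n + 1 <= #|D| by arith.
apply: (no_cycle (i := cl (~~ d))); apply: (Dirac_sub (Esym _) cD) => x xD.
apply: leq_trans (_ : #|P x| <= n); last by rewrite leqNgt (small x xD).
apply/subset_leq_card/subsetP => y /setIdP[yD].
rewrite inE (subsetP DA y yD) /=.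
have [-> _|yx /= ncxy] := eqVneq y x; first exact: part_refl.
apply: contraR ncxy => nxy; rewrite -color_cases ?(subsetP DA) //.
by apply: avD => //; rewrite eq_sym.
Qed.

Lemma three_large_aux d x1 x2 x3 : x1 \in A -> x2 \in A -> x3 \in A ->
  ~~ part x1 x2 -> ~~ part x1 x3 -> ~~ part x2 x3 ->
  large x1 -> large x2 -> large x3 ->
  c x1 x2 = cl d -> c x1 x3 = cl d -> c x2 x3 = cl (~~ d) ->
  #|A| + #|X true| + #|X false| + w <= 4 * u.
Proof.
move=> x1A x2A x3A n12 n13 n23 l1 l2 l3 c12 c13 c23.
have X0 e : X e = set0.
  have [->|ed] := eqVneq e d; first exact: no_attached c12.
  by rewrite (neq_negb ed); apply: no_attached c23.
pose Q := P x2 :|: P x3; pose U := A :\: Q.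
have QA : Q \subset A by rewrite subUset !part_sub.
have cQ : #|Q| = #|P x2| + #|P x3|.
  by rewrite cardsU disjoint_setI0 ?part_disjoint // cards0 subn0.
have cA : #|A| = #|U| + #|Q|.
  by rewrite cardsD (setIidPr QA) subnK // subset_leq_card.
have dQ : [disjoint Q & P x1].
  rewrite -setI_eq0 setIUl setU_eq0 !setI_eq0.
  by apply/andP; split; apply: part_disjoint; rewrite part_sym.
have cQ1 : {in Q & P x1, forall x y, c x y = cl d}.
  move=> x y /setUP[xQ|xQ] y1; rewrite c_sym.
    by rewrite (parts_complete x1A x2A n12).
  by rewrite (parts_complete x1A x3A n13).
(* Each vertex of [U] off [P x1] is joined in color [cl d] to [P x2] or to
   [P x3], and in the other color to [P x1]. *)
have outside v : v \in U -> v \notin P x1 ->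
    c v x1 = cl (~~ d) /\ exists2 x, P x \subset Q & 1 < #|P x| /\
      {in P x, forall z, c v z = cl d}.
  move=> vU v1; have [vA vQ] := setDP vU.
  move: (vQ); rewrite in_setU negb_or => /andP[v2 v3].
  have np x : v \notin P x -> ~~ part x v by rewrite inE vA.
  have np' x : v \notin P x -> ~~ part v x by move/np; rewrite part_sym.
  have not_both : ~ (c v x2 = cl (~~ d) /\ c v x3 = cl (~~ d)).
    by case=> cv2 cv3; apply: no_apex c23 cv2 cv3.
  have toQ x : x \in A -> v \notin P x -> c v x = cl d ->
      {in P x, forall z, c v z = cl d}.
    by move=> xA vx cvx z zx; rewrite (color_from_part xA vA (np _ vx) zx).
  have dec x : x \in A -> v \notin P x -> c v x = cl d \/ c v x = cl (~~ d).
    move=> xA vx; have := color_cases vA xA (np' _ vx) d.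
    by case: eqP => [|_ /esym/eqP]; [left | right].
  split.
    case: (dec _ x1A v1) => // cv1.
    case: (dec _ x2A v2) => cv2; first by case: (no_apex x1A x2A n12 l1 l2 v1 v2 c12).
    case: (dec _ x3A v3) => cv3; first by case: (no_apex x1A x3A n13 l1 l3 v1 v3 c13).
    by case: not_both.
  case: (dec _ x2A v2) => cv2.
    exists x2; first exact: subsetUl.
    by split; [apply: ltn_trans l2 | apply: toQ].
  case: (dec _ x3A v3) => cv3; last by case: not_both.
  exists x3; first exact: subsetUr.
  by split; [apply: ltn_trans l3 | apply: toQ].
have UdNP y : y \in U -> y \notin Q by case/setDP.
have avU : avoids (cl d) U.
  move=> y z yU zU yz; have [yA _] := setDP yU; have [zA _] := setDP zU.
  have one t t' : t \in U -> t' \in U -> t \in P x1 -> t' \notin P x1 ->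
      c t' t != cl d.
    move=> tU t'U t1 t'1; have [ct' _] := outside t' t'U t'1.
    have [t'A _] := setDP t'U.
    have nt' : ~~ part x1 t' by move: t'1; rewrite inE t'A.
    by rewrite (color_from_part x1A t'A nt' t1) ct' eq_sym cl_neq.
  have [y1|y1] := boolP (y \in P x1); have [z1|z1] := boolP (z \in P x1).
  - exact: (part_avoids x1A x2A n12 l1 l2 c12).
  - by rewrite c_sym one.
  - by rewrite one.
  have [_ [x xQ [xn cyx]]] := outside y yU y1.
  have [_ [x' x'Q [x'n czx']]] := outside z zU z1.
  have /card_gt0P[t tx] : 0 < #|P x| by apply: ltnW.
  have /card_gt0P[t'] : 0 < #|P x' :\ t|.
    by move: x'n; rewrite (cardsD1 t (P x')); case: (t \in _); arith.
  case/setD1P => t't t'x'; apply/negP => cyz; apply: (no_cycle (i := cl d)).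
  apply: (outer_edge_cycle (Esym _) dQ _ n1 _ _ _ _ yz cyz (subsetP xQ _ tx)
    (subsetP x'Q _ t'x')); rewrite /= ?cyx ?czx' //.
  - by move=> v v' vQ v'1; rewrite /= cQ1.
  - by rewrite cQ; apply: leq_trans (ltnW l2) (leq_addr _ _).
  - by apply: leq_trans (ltnW l1) _.
  - by rewrite in_setU negb_or UdNP.
  - by rewrite in_setU negb_or UdNP.
  - by rewrite eq_sym.
have pU : U \proper A.
  rewrite properE subsetDl; apply/subsetPn; exists x2 => //.
  by rewrite in_setD in_setU part_self.
have bU := bound1 pU avU (Y := set0).
have {}bU : #|U| + w <= 2 * u.
  move: bU; rewrite cards0 addn0; apply=> //; first by rewrite -setI_eq0 set0I.
  by move=> v v'; rewrite in_set0.
have av_both x : x \in A -> (forall e, avoids (cl e) (P x)) -> #|P x| + w <= u.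
  by move=> _; apply: bound2; apply: part_proper.
have two e : e = d \/ e = ~~ d.
  by have [|/neq_negb] := eqVneq e d; [left | right].
have b2 : #|P x2| + w <= u.
  apply: av_both => // e; case: (two e) => ->.
    by apply: (part_avoids x2A x1A _ l2 l1); rewrite 1?part_sym 1?c_sym.
  exact: (part_avoids x2A x3A).
have b3 : #|P x3| + w <= u.
  apply: av_both => // e; case: (two e) => ->.
    by apply: (part_avoids x3A x1A _ l3 l1); rewrite 1?part_sym 1?c_sym.
  by apply: (part_avoids x3A x2A _ l3 l2); rewrite 1?part_sym 1?c_sym.
by rewrite !X0 !cards0 cA cQ; arith.
Qed.

Lemma three_large x1 x2 x3 : x1 \in A -> x2 \in A -> x3 \in A ->
  ~~ part x1 x2 -> ~~ part x1 x3 -> ~~ part x2 x3 ->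
  large x1 -> large x2 -> large x3 ->
  #|A| + #|X true| + #|X false| + w <= 4 * u.
Proof.
move=> x1A x2A x3A n12 n13 n23 l1 l2 l3.
have [d12 c12] := reduced x1A x2A n12.
have [d13 c13] := reduced x1A x3A n13.
have [d23 c23] := reduced x2A x3A n23.
have c21 : c x2 x1 = cl d12 by rewrite c_sym.
have c31 : c x3 x1 = cl d13 by rewrite c_sym.
have c32 : c x3 x2 = cl d23 by rewrite c_sym.
have n21 : ~~ part x2 x1 by rewrite part_sym.
have n31 : ~~ part x3 x1 by rewrite part_sym.
have n32 : ~~ part x3 x2 by rewrite part_sym.
have out x y : x \in A -> ~~ part x y -> x \notin P y.
  by move=> xA nxy; rewrite inE xA part_sym.
have [E1|E1] := eqVneq d12 d13.
  have [E2|E2] := eqVneq d23 d12.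
    have [] := no_apex x1A x2A n12 l1 l2 (out _ _ x3A n31) (out _ _ x3A n32) c12.
      by rewrite c31 E1.
    by rewrite c32 E2.
  apply: (@three_large_aux d12 x1 x2 x3) => //; first by rewrite c13 E1.
  by rewrite c23 (neq_negb E2).
have [E2|E2] := eqVneq d12 d23.
  apply: (@three_large_aux d12 x2 x1 x3) => //; first by rewrite c23 E2.
  by rewrite c13 (neq_negb E1) negbK.
apply: (@three_large_aux d13 x3 x1 x2) => //.
  rewrite c32; congr cl; rewrite -[d23]negbK -(neq_negb E2).
  by rewrite (neq_negb E1) negbK.
by rewrite c12 (neq_negb E1).
Qed.

Lemma sum_attached d : #|X true| + #|X false| = #|X d| + #|X (~~ d)|.
Proof. by case: d => //=; rewrite addnC. Qed.

Lemma color_dec x y d : x \in A -> y \in A -> ~~ part x y ->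
  c x y = cl d \/ c x y = cl (~~ d).
Proof.
move=> xA yA nxy; have := color_cases xA yA nxy d.
by case: eqP => [|_ /esym/eqP]; [left | right].
Qed.

Section TwoLarge.
Variables (x1 x2 : V) (d : bool).
Hypotheses (x1A : x1 \in A) (x2A : x2 \in A) (n12 : ~~ part x1 x2).
Hypotheses (l1 : large x1) (l2 : large x2) (c12 : c x1 x2 = cl d).
Let R := A :\: (P x1 :|: P x2).
Let D x := [set v in R | c v x == cl (~~ d)].

Let RP v : v \in R -> [/\ v \in A, v \notin P x1, v \notin P x2,
  ~~ part v x1 & ~~ part v x2].
Proof.
case/setDP => vA; rewrite in_setU negb_or => /andP[v1 v2]; split=> //.
  by move: v1; rewrite inE vA part_sym.
by move: v2; rewrite inE vA part_sym.
Qed.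

Let cA : #|A| = #|P x1| + #|P x2| + #|R|.
Proof.
rewrite /R cardsD (setIidPr _) ?subUset ?part_sub // cardsU.
rewrite disjoint_setI0 ?part_disjoint // cards0 subn0 subnKC //.
have <- : #|P x1 :|: P x2| = #|P x1| + #|P x2|.
  by rewrite cardsU disjoint_setI0 ?part_disjoint // cards0 subn0.
by apply: subset_leq_card; rewrite subUset !part_sub.
Qed.

Let in_far v : v \in R :\: D x1 -> c v x1 = cl d /\ c v x2 = cl (~~ d).
Proof.
case/setDP => vR; have [vA v1 v2 nv1 nv2] := RP vR.
rewrite inE vR -(color_cases vA x1A nv1) negbK => /eqP cv1; split=> //.
case: (color_dec d vA x2A nv2) => // cv2.
by case: (no_apex x1A x2A n12 l1 l2 v1 v2 c12 cv1 cv2).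
Qed.

Let from_part v x z : x \in A -> v \in A -> ~~ part v x -> z \in P x ->
  c v z = c v x.
Proof. by move=> xA vA nvx; apply: color_from_part; rewrite // part_sym. Qed.

Let far_avoids : avoids (cl d) (P x2 :|: (R :\: D x1)).
Proof.
have n21 : ~~ part x2 x1 by rewrite part_sym.
have av2 : avoids (cl d) (P x2) by apply: (part_avoids x2A x1A); rewrite 1?c_sym.
have cross y z : y \in P x2 -> z \in R :\: D x1 -> c z y != cl d.
  move=> y2 zF; have [_ cz] := in_far zF.
  have [zA _ _ _ nz2] := RP (subsetP (subsetDl _ _) _ zF).
  by rewrite (from_part x2A zA nz2 y2) cz eq_sym cl_neq.
move=> y z /setUP[yP|yF] /setUP[zP|zF] yz.
- exact: av2.
- by rewrite c_sym cross.
- exact: cross.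
have [cy _] := in_far yF; have [cz _] := in_far zF.
have [yA y1 y2 ny _] := RP (subsetP (subsetDl _ _) _ yF).
have [zA z1 z2 nz _] := RP (subsetP (subsetDl _ _) _ zF).
have [t t1 tx] : exists2 t, t \in P x1 & x1 != t.
  have /card_gt0P[t] : 0 < #|P x1 :\ x1|.
    by move: l1; rewrite /large (cardsD1 x1) part_self //; move: n1; arith.
  by case/setD1P => tx t1; exists t; rewrite 1?eq_sym.
apply/negP => cyz; apply: (no_cycle (i := cl d)).
apply: (outer_edge_cycle (Esym _) (part_disjoint n12) _ n1 _ _ _ _ yz cyz
  (part_self x1A) t1 tx); rewrite /= ?cy ?(from_part x1A zA nz t1) ?cz //.
- by move=> v v' v1 v2; rewrite /= (parts_complete x1A x2A n12) // c12.
- exact: ltnW.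
- by rewrite ltnW // ltnS ltnW.
- by rewrite in_setU negb_or y1.
- by rewrite in_setU negb_or z1.
Qed.

Lemma two_large_few : #|D x1 :|: X (~~ d)| < n ->
  #|A| + #|X true| + #|X false| + w <= 4 * u.
Proof.
move=> few; have X0 := no_attached x1A x2A n12 l1 l2 c12.
have DA : D x1 \subset A.
  by apply/subsetP => v /setIdP[/RP[]].
have dDX : [disjoint D x1 & X (~~ d)].
  by rewrite disjoint_sym; apply: disjointWr DA (dXA _).
have cDX : #|D x1 :|: X (~~ d)| = #|D x1| + #|X (~~ d)|.
  by rewrite cardsU disjoint_setI0 // cards0 subn0.
have b1 : #|P x1| + #|D x1 :|: X (~~ d)| + w <= 2 * u.
  apply: (bound1 (d := d) (part_proper x1)) => //.
  - exact: part_avoids x1A x2A n12 l1 l2 c12.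
  - rewrite -setI_eq0 setIUl setU_eq0 !setI_eq0; apply/andP; split.
      rewrite disjoint_sym; apply/pred0P => v; apply/negP => /andP[/= v1].
      by case/setIdP=> /RP[_]; rewrite v1.
    exact: disjointWr (part_sub x1) (dXA _).
  move=> v z vY z1; case/setUP: vY => [/setIdP[vR /eqP cv]|vX].
    by have [vA _ _ nv1 _] := RP vR; rewrite (from_part x1A vA nv1 z1).
  by apply: cXA => //; apply: (subsetP (part_sub x1)).
have dPF : [disjoint P x2 & R :\: D x1].
  apply/pred0P => v; apply/negP => /andP[/= v2 /setDP[/RP[_ _]]].
  by rewrite v2.
have cF : #|P x2 :|: (R :\: D x1)| = #|P x2| + #|R :\: D x1|.
  by rewrite cardsU disjoint_setI0 // cards0 subn0.
have sub2 : P x2 :|: (R :\: D x1) \proper A.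
  rewrite properE subUset part_sub (subset_trans (subsetDl _ _) (subsetDl _ _)) /=.
  apply/subsetPn; exists x1 => //; rewrite in_setU negb_or.
  have -> : x1 \notin P x2 by rewrite inE x1A part_sym.
  by rewrite !in_setD in_setU part_self //= andbF.
have b2 := bound1 sub2 far_avoids (Y := set0).
have {}b2 : #|P x2| + #|R :\: D x1| + w <= 2 * u.
  move: b2; rewrite cF cards0 addn0; apply=> //; first by rewrite -setI_eq0 set0I.
  by move=> v v'; rewrite in_set0.
have cR : #|R| = #|D x1| + #|R :\: D x1|.
  by rewrite cardsD (setIidPr _) ?subnKC ?subset_leq_card //; apply/subsetP => v /setIdP[].
by have := sum_attached d; rewrite X0 cards0 cA cR; arith.
Qed.

Lemma two_large_many : n <= #|D x1 :|: X (~~ d)| -> n <= #|D x2 :|: X (~~ d)| ->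
  {in R, forall v, ~~ large v} ->
  #|A| + #|X true| + #|X false| + w <= 4 * u.
Proof.
move=> m1 m2 small; have X0 := no_attached x1A x2A n12 l1 l2 c12.
have attach x v z : x \in A -> v \in D x :|: X (~~ d) ->
    (forall y, y \in R -> ~~ part y x) -> z \in P x -> c v z = cl (~~ d).
  move=> xA vY nx zx; case/setUP: vY => [/setIdP[vR /eqP cv]|vX].
    by have [vA _ _ _ _] := RP vR; rewrite (from_part xA vA (nx _ vR) zx).
  by apply: cXA => //; apply: (subsetP (part_sub x)).
have nx1 y : y \in R -> ~~ part y x1 by case/RP.
have nx2 y : y \in R -> ~~ part y x2 by case/RP.
have disj x : {in R, forall v, v \notin P x} -> [disjoint P x & D x :|: X (~~ d)].
  move=> vx; rewrite -setI_eq0 setIUr setU_eq0 !setI_eq0; apply/andP; split.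
    by apply/pred0P => v; apply/negP => /andP[/= v1 /setIdP[/vx]]; rewrite v1.
  by rewrite disjoint_sym; apply: disjointWr (part_sub x) (dXA _).
have loses x y : x \in A -> y \in A -> ~~ part x y -> large x -> large y ->
    c x y = cl d -> n <= #|D x :|: X (~~ d)| -> {in R, forall v, ~~ part v x} ->
    {in R, forall v, v \notin P x} -> #|P x| + w <= u.
  move=> xA yA nxy lx ly cxy mx nx vx; apply: bound2 (part_proper x) _ => e.
  have [->|/neq_negb ->] := eqVneq e d; first exact: part_avoids cxy.
  apply: inner_edgeE (disj x vx) _ lx mx => z v zx vY.
  by rewrite c_sym (attach x).
have b1 : #|P x1| + w <= u.
  by apply: (loses x1 x2) => // v /RP[].
have b2 : #|P x2| + w <= u.
  by apply: (loses x2 x1) => //; rewrite 1?part_sym 1?c_sym // => v /RP[].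
have D1 : #|D x1| <= 2 * n.
  rewrite leqNgt; apply/negP => big.
  have DA : D x1 \subset A by apply/subsetP => v /setIdP[/RP[]].
  have : #|D x1| <= 2 * n; last by rewrite leqNgt big.
  apply: (@small_parts_bound (~~ d)) => //.
    by move=> v /setIdP[/small].
  apply: (@inner_edgeE _ _ (P x1)).
  - rewrite disjoint_sym; apply: disjointWr (subsetUl _ _) (disj x1 _).
    by move=> v /RP[].
  - by move=> v z vD z1; apply: (attach x1) => //; rewrite inE vD.
  - by apply: leq_ltn_trans big; rewrite leq_pmull.
  - exact: ltnW.
have cF : #|R :\: D x1| <= n.
  rewrite leqNgt; apply/negP => big.
  have /card_gt0P[v vF] : 0 < #|R :\: D x1| by apply: leq_ltn_trans big.
  have FR : R :\: D x1 \subset R by apply: subsetDl.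
  have : ~~ large v by apply/small/(subsetP FR).
  case/negP; apply: (leq_trans big).
  apply/subset_leq_card/subsetP => z zF.
  have [[vA _ _ _ _] [zA _ _ _ _]] := (RP (subsetP FR _ vF), RP (subsetP FR _ zF)).
  rewrite inE zA; apply/negPn/negP => nvz.
  have vz : v != z by apply: contraNneq nvz => ->; apply: part_refl.
  have av1 : c v z != cl d by apply: far_avoids => //; rewrite inE ?vF ?zF orbT.
  have : c v z != cl (~~ d); last by rewrite color_cases // negbK (negbTE av1).
  apply: (inner_edgeE (Y := R :\: D x1) (Z := P x2)) => //; last exact: ltnW.
    rewrite disjoint_sym; apply/pred0P => y; apply/negP => /andP[/= y2 /setDP[/RP[_ _]]].
    by rewrite y2.
  move=> y t yF t2; have [_ cy] := in_far yF.
  by have [yA _ _ _ ny2] := RP (subsetP FR _ yF); rewrite (from_part x2A yA ny2 t2).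
have cR : #|R| = #|D x1| + #|R :\: D x1|.
  by rewrite cardsD (setIidPr _) ?subnKC ?subset_leq_card //; apply/subsetP => ? /setIdP[].
have := sum_attached d; have := Xn (~~ d); rewrite X0 cards0 cA cR; arith.
Qed.

End TwoLarge.

Lemma two_large x1 x2 : x1 \in A -> x2 \in A -> ~~ part x1 x2 ->
  large x1 -> large x2 -> {in A, forall v, large v -> part x1 v || part x2 v} ->
  #|A| + #|X true| + #|X false| + w <= 4 * u.
Proof.
move=> x1A x2A n12 l1 l2 only; have [d c12] := reduced x1A x2A n12.
have n21 : ~~ part x2 x1 by rewrite part_sym.
have c21 : c x2 x1 = cl d by rewrite c_sym.
have few1 := two_large_few x1A x2A n12 l1 l2 c12.
have few2 := two_large_few x2A x1A n21 l2 l1 c21.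
have many := two_large_many x1A x2A n12 l1 l2 c12.
rewrite (setUC (P x2)) in few2.
case: (ltnP _ n) few1 => [_ few1 | m1 _]; first exact: few1.
case: (ltnP _ n) few2 => [_ few2 | m2 _]; first exact: few2.
apply: many m1 m2 _ => v; rewrite in_setD in_setU => /andP[nv vA].
by apply: contra nv => /(only _ vA); rewrite !inE vA.
Qed.

Section AroundPart.
Variable x1 : V.
Hypothesis x1A : x1 \in A.
Let D d := [set v in A :\: P x1 | c v x1 == cl d].
Let Y d := D d :|: X d.

Let DP d v : v \in D d -> [/\ v \in A, v \notin P x1, ~~ part v x1 & c v x1 = cl d].
Proof.
case/setIdP => /setDP[vA v1] /eqP cv; split=> //.
by move: v1; rewrite inE vA part_sym.
Qed.

Let DA d : D d \subset A. Proof. by apply/subsetP => v /DP[]. Qed.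

Let cY d : #|Y d| = #|D d| + #|X d|.
Proof.
rewrite cardsU disjoint_setI0 ?cards0 ?subn0 // disjoint_sym.
exact: disjointWr (DA d) (dXA d).
Qed.

Let cA : #|A| = #|P x1| + (#|D true| + #|D false|).
Proof.
have -> : #|D true| + #|D false| = #|A :\: P x1|.
  have <- : D true :|: D false = A :\: P x1.
    apply/setP => v; rewrite in_setU !in_set -andb_orr.
    apply: andb_idr => /andP[v1 vA].
    have nv : ~~ part v x1 by move: v1; rewrite vA part_sym.
    by case: (color_dec true vA x1A nv) => ->; rewrite eqxx ?orbT.
  rewrite cardsU disjoint_setI0 ?cards0 ?subn0 //.
  apply/pred0P => v; apply/negP => /andP[/DP[_ _ _ cv] /DP[_ _ _ /eqP]].
  by rewrite cv (negbTE (cl_neq true)).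
rewrite cardsD (setIidPr (part_sub _)) subnKC // subset_leq_card //.
exact: part_sub.
Qed.

Let dYP d : [disjoint P x1 & Y d].
Proof.
rewrite -setI_eq0 setIUr setU_eq0 !setI_eq0; apply/andP; split.
  by apply/pred0P => v; apply/negP => /andP[/= v1 /DP[_]]; rewrite v1.
by rewrite disjoint_sym; apply: disjointWr (part_sub x1) (dXA _).
Qed.

Let cYP d : {in Y d & P x1, forall v z, c v z = cl d}.
Proof.
move=> v z /setUP[/DP[vA _ nv cv]|vX] z1.
  by rewrite (color_from_part x1A vA _ z1) // part_sym.
by apply: cXA => //; apply: (subsetP (part_sub x1)).
Qed.

Section OneLarge.
Hypothesis l1 : large x1.
Hypothesis only1 : {in A, forall v, large v -> part x1 v}.

Let D2n d : #|D d| <= 2 * n.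
Proof.
rewrite leqNgt; apply/negP => big.
have : #|D d| <= 2 * n; last by rewrite leqNgt big.
apply: (@small_parts_bound d) => // [v /DP[vA _ nv _]|].
  by apply: contra nv => /(only1 vA); rewrite part_sym.
apply: (@inner_edgeE _ _ (P x1)).
- by rewrite disjoint_sym; apply: disjointWr (subsetUl _ _) (dYP d).
- by move=> v z vD; apply: cYP; rewrite inE vD.
- by apply: leq_ltn_trans big; rewrite leq_pmull.
- exact: ltnW.
Qed.

Let loses d : n <= #|Y d| -> avoids (cl d) (P x1).
Proof.
move=> nY; apply: inner_edgeE (dYP d) _ l1 nY => z v z1 vY.
by rewrite c_sym (cYP vY).
Qed.

Let one_dead d : n <= #|Y d| -> #|Y (~~ d)| < n ->
  #|P x1| + #|Y (~~ d)| + w <= 2 * u.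
Proof.
move=> nY Yn; apply: (bound1 (d := d) (part_proper x1) (loses nY) Yn).
  by rewrite disjoint_sym.
exact: cYP.
Qed.

Lemma one_large : #|A| + #|X true| + #|X false| + w <= 4 * u.
Proof.
have [Xt Xf] := (Xn true, Xn false).
have [Dt Df] := (D2n true, D2n false); have [ct cf] := (cY true, cY false).
rewrite cA; have [ft|mt] := ltnP #|Y true| n; have [ff|mf] := ltnP #|Y false| n.
- have : #|P x1| + #|Y true| + #|Y false| + w <= 4 * u.
    apply: bound0 (part_proper x1) _ _ _ => [[]|d|d] //.
    by rewrite disjoint_sym.
  by rewrite ct cf; arith.
- by have := one_dead mf ft; rewrite ct; arith.
- by have := one_dead mt ff; rewrite cf; arith.
have : #|P x1| + w <= u.
  by apply: bound2 (part_proper x1) _ => -[]; apply: loses.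
by arith.
Qed.

End OneLarge.

Section NoneLarge.
Hypothesis small : {in A, forall v, ~~ large v}.
Hypothesis largest : {in A, forall v, #|P v| <= #|P x1|}.
Hypothesis m1 : 1 < #|P x1|.
Let W d := P x1 :|: X d.

Let cW d : #|W d| = #|P x1| + #|X d|.
Proof.
rewrite cardsU disjoint_setI0 ?cards0 ?subn0 // disjoint_sym.
exact: disjointWr (part_sub x1) (dXA d).
Qed.

Let dWD d : [disjoint W d & D d].
Proof.
rewrite -setI_eq0 setIUl setU_eq0 !setI_eq0; apply/andP; split.
  exact: disjointWr (subsetUl _ _) (dYP d).
exact: disjointWr (DA d) (dXA d).
Qed.

Let cWD d : {in W d & D d, forall z v, c z v = cl d}.
Proof.
move=> z v /setUP[z1|zX] vD.
  by rewrite c_sym (cYP (d := d)) // inE vD.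
by apply: cXA => //; apply: (subsetP (DA d)).
Qed.

Let full d : n <= #|W d| -> #|D d| <= 2 * n.
Proof.
move=> nW; rewrite leqNgt; apply/negP => big.
have : #|D d| <= 2 * n; last by rewrite leqNgt big.
apply: (@small_parts_bound d) => // [v /DP[vA _ _ _]|]; first exact: small.
apply: (@inner_edgeE _ _ (W d)) => //; first by rewrite disjoint_sym.
- by move=> v z vD zW; rewrite c_sym (cWD zW).
- by apply: leq_ltn_trans big; rewrite leq_pmull.
Qed.

Let sparse d : #|W d| < n -> 2 * (#|D d| + #|W d|) < 7 * n + 4.
Proof.
move=> Wn; rewrite ltnNge; apply/negP => cD.
apply: (sparse_red (red := E (cl d)) (blue := E (cl (~~ d))) (part := part)
  (T := W d) (R := D d) (n := n) (m := #|P x1|) (t := #|W d|)) => //.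
- move=> x y /DP[xA _ _ _] /DP[yA _ _ _] nxy.
  by case: (color_dec d xA yA nxy) => ->; rewrite eqxx ?orbT.
- move=> x xD; apply: leq_trans (largest (subsetP (DA d) _ xD)).
  apply/subset_leq_card/subsetP => y /setIdP[yD xy].
  by rewrite inE (subsetP (DA d)).
- by rewrite cW leq_addr.
- by move=> z v zW vD; rewrite /= (cWD zW).
Qed.

Lemma none_large_aux : #|A| + #|X true| + #|X false| <= 7 * n + 1.
Proof.
have mn : #|P x1| <= n by rewrite leqNgt; apply: small.
have := (cW true, cW false, Xn true, Xn false).
case=> [[[ct cf] xt] xf]; rewrite cA.
have [ft|mt] := ltnP #|W true| n; have [ff|mf] := ltnP #|W false| n.
- by have := (sparse ft, sparse ff); case; arith.
- by have := (sparse ft, full mf); case; arith.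
- by have := (full mt, sparse ff); case; arith.
- by have := (full mt, full mf); case; arith.
Qed.

End NoneLarge.
End AroundPart.

Lemma none_large : {in A, forall v, ~~ large v} ->
  #|A| + #|X true| + #|X false| + w <= 4 * u.
Proof.
move=> small; suff : #|A| + #|X true| + #|X false| <= 7 * n + 1 by arith.
case: (arg_maxnP (fun x => #|P x|) x0A) => x1 x1A largest.
have [m1|m1] := leqP #|P x1| 1; last exact: (none_large_aux x1A small largest m1).
apply: (@leq_trans (4 * n)); last by arith.
apply: (two_colors c_sym n4 no_cycle _ Xn dXA cXA) => x y xA yA xy.
apply: reduced => //; apply: contra xy => pxy; apply/eqP.
by apply: (card_le1_eqP (leq_trans (largest x xA) m1));
  rewrite inE ?xA ?yA ?part_refl ?pxy.
Qed.

Lemma reduced_step : #|A| + #|X true| + #|X false| + w <= 4 * u.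
Proof.
have [/exists_inP[x1 x1A l1]|none] := boolP [exists x in A, large x]; last first.
  by apply: none_large => v vA; apply: contra none => lv; apply/exists_inP; exists v.
have [/exists_inP[x2 x2A /andP[n12 l2]]|only1] :=
    boolP [exists x in A, ~~ part x1 x && large x]; last first.
  apply: (one_large x1A l1) => v vA lv; apply: contraR only1 => nv.
  by apply/exists_inP; exists v; rewrite // nv.
have [/exists_inP[x3 x3A /and3P[n13 n23 l3]]|only2] :=
    boolP [exists x in A, [&& ~~ part x1 x, ~~ part x2 x & large x]].
  exact: three_large n12 n13 n23 l1 l2 l3.
apply: (two_large x1A x2A n12 l1 l2) => v vA lv; apply: contraR only2.
rewrite negb_or => /andP[nv1 nv2]; apply/exists_inP; exists v => //.
by rewrite nv1 nv2.
Qed.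

End ReducedStep.

(** * The upper bound *)

(* [X i] collects vertices outside [A] joined to all of [A] in color [i]; this
   is what survives of the small parts when the induction moves to a larger
   part. *)
Lemma attached_bound (V T : finType) (c : V -> V -> T) (n : nat)
    (A : {set V}) (S : {set T}) (X : T -> {set V}) :
  (forall x y, c x y = c y x) ->
  (forall x y z, x != y -> y != z -> x != z ->
     [|| c x y == c y z, c y z == c x z | c x y == c x z]) ->
  3 < n -> n <= 5 ->
  (forall i, ~ has_cycle (fun x y => c x y == i) (2 * n + 1)) ->
  {in A &, forall x y, x != y -> c x y \in S} ->
  {in S, forall i, #|X i| < n} -> {in S, forall i, [disjoint X i & A]} ->
  {in S, forall i, {in X i & A, forall x a, c x a = i}} ->
  #|A| + \sum_(i in S) #|X i| <= n * 2 ^ #|S|.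
Proof.
move=> c_sym gallai n4 n5 no_cycle.
have Esym i : symmetric (fun x y => c x y == i) by move=> x y; rewrite c_sym.
have [m] := ubnP #|A|; elim: m A S X => // m IH A S X Am colA Xn dXA cXA.
have sum_le (S' : {set T}) : S' \subset S -> \sum_(i in S') #|X i| <= #|S'| * n.-1.
  move=> SS; rewrite -sum_nat_const; apply: leq_sum => i iS.
  by rewrite -ltnS prednK ?Xn ?(subsetP SS) //; arith.
have [An|nA] := leqP #|A| n.
  apply: (@leq_trans (n + #|S| * n.-1)); first by rewrite leq_add ?sum_le.
  apply: (@leq_trans (n * #|S|.+1)); last by rewrite leq_mul2l ltn_expl ?orbT.
  by rewrite mulnS mulnC leq_add2l leq_mul2r leq_pred orbT.
have /card_gt1P[x0 [y0 [x0A y0A xy0]]] : 1 < #|A| by arith.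
have c0S := colA _ _ x0A y0A xy0.
have [S2|S2] := leqP #|S| 2.
  have [S1|S1] := leqP #|S| 1.
    have ES : S = [set c x0 y0].
      by apply/eqP; rewrite eq_sym eqEcard sub1set c0S cards1.
    rewrite ES big_set1 cards1 leqNgt; apply/negP => big.
    set i := c x0 y0 in big c0S ES; apply: (no_cycle i).
    have colA' : {in A &, forall x y, x != y -> c x y = i}.
      by move=> x y xA yA xy; apply/eqP; rewrite -in_set1 -ES colA.
    apply: (clique_join_cycle (K := A) (W := A :|: X i)) => //; first by arith.
    - exact: subsetUl.
    - rewrite cardsU disjoint_setI0 ?cards0; last by rewrite disjoint_sym dXA.
      by arith.
    - move=> x y xA /setUP[yA|yX] xy; first by rewrite colA'.
      by rewrite c_sym (cXA i c0S).
  have /cards2P[a [b [ab ES]]] : #|S| == 2 by rewrite eqn_leq S2.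
  have [aS bS] : a \in S /\ b \in S by rewrite ES !inE !eqxx orbT.
  pose cl d := if d : bool then a else b.
  have clS d : cl d \in S by case: d.
  have -> : \sum_(i in S) #|X i| = #|X a| + #|X b|.
    by rewrite ES big_setU1 ?inE //= big_set1.
  rewrite addnA ES cards2 ab (_ : n * 2 ^ 2 = 4 * n); last by arith.
  apply: (two_colors c_sym n4 no_cycle (cl := cl) (X := fun d => X (cl d))).
  - move=> x y xA yA xy; have := colA x y xA yA xy.
    by rewrite ES !inE => /orP[]/eqP->; [exists true | exists false].
  - by move=> d; apply: Xn.
  - by move=> d; apply: dXA.
  - by move=> d; apply: cXA.
have A1 : 1 < #|A| by arith.
have [a [b [x1 [y1 [aS bS ab x1A [y1A nxy]]]]]] :=
  gallai_partition c_sym gallai A1 (ltnW S2) colA.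
pose cl d := if d : bool then a else b.
have clS d : cl d \in S by case: d.
have cl_neq d : cl d != cl (~~ d) by case: d; rewrite //= eq_sym.
have two d : S :\ cl d :\ cl (~~ d) = S :\ a :\ b.
  by case: d => //=; apply/setP => z; rewrite !inE andbCA.
set s0 := #|S :\ a :\ b|.
have cS1 d : #|S :\ cl d| = s0.+1.
  by rewrite (cardsD1 (cl (~~ d))) two !inE eq_sym cl_neq clS.
have cS : #|S| = s0.+2 by rewrite (cardsD1 (cl true)) clS cS1.
pose w := \sum_(i in S :\ a :\ b) #|X i|.
have sumX (Y : T -> {set V}) d : {in S :\ a :\ b, Y =1 X} ->
    \sum_(i in S :\ cl d) #|Y i| = #|Y (cl (~~ d))| + w.
  move=> YX; rewrite (big_setD1 (cl (~~ d))) /=; last first.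
    by rewrite !inE eq_sym cl_neq clS.
  by rewrite two; congr (_ + _); apply: eq_bigr => i iS; rewrite YX.
have -> : \sum_(i in S) #|X i| = #|X a| + (#|X b| + w).
  by rewrite (big_setD1 a) //= -(sumX X true).
rewrite cS !expnS !addnA.
have -> : n * (2 * (2 * 2 ^ s0)) = 4 * (n * 2 ^ s0) by arith.
have lost d (B : {set V}) : B \subset A -> avoids c (cl d) B ->
    {in B &, forall x y, x != y -> c x y \in S :\ cl d}.
  move=> BA av x y xB yB xy.
  by rewrite !inE av // colA // (subsetP BA).
have sub_card (B : {set V}) : B \proper A -> #|B| < m.
  by move=> /proper_card BA; apply: leq_trans BA _.
have disjB (B Y : {set V}) : B \subset A -> [disjoint Y & A] -> [disjoint Y & B].
  by move=> BA; apply: disjointWr.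
apply: (reduced_step c_sym n4 n5 no_cycle (X := fun d => X (cl d)) (cl := cl)
  (part := same_part c a b A) cl_neq _ _ _ _ _ x1A y1A nxy).
- exact: same_part_refl.
- exact: same_part_sym.
- by move=> y x z; apply: same_part_trans.
- by move=> x x' y xA yA; apply: same_part_color.
- move=> x y xA yA /(reduced_color xA yA); rewrite !inE.
  by case/orP=> /eqP->; [exists true | exists false].
- by move=> d; apply: Xn.
- by move=> d; apply: dXA.
- by move=> d; apply: cXA.
- rewrite mulnC leq_mul2l; apply/orP; right.
  have s0_gt0 : 0 < s0 by arith.
  by rewrite -(prednK s0_gt0) expnS leq_pmulr // expn_gt0.
- have w_le : w <= s0 * n.-1.
    by apply: sum_le; apply: subset_trans (subsetDl _ _) (subsetDl _ _).
  have s0_gt0 : 0 < s0 by arith.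
  have : s0 < 2 ^ s0 by apply: ltn_expl.
  move: w_le s0_gt0 n4; clear; case: n => // n' /= w_le s0_gt0 n4.
  by move: (2 ^ s0) => e es; nia.
- move=> B pB av; have BA := proper_sub pB.
  apply: (IH B (S :\ a :\ b) X (sub_card _ pB)).
  + move=> x y xB yB xy; rewrite in_setD1 (av false) //.
    exact: (lost true B BA (av true)).
  + by move=> i /setD1P[_ /setD1P[_ /Xn]].
  + by move=> i /setD1P[_ /setD1P[_ /dXA]]; apply: disjB.
  + move=> i /setD1P[_ /setD1P[_ iS]] x y xX yB.
    by apply: cXA => //; apply: (subsetP BA).
- move=> d B Y pB av Yn dYB cYB; have BA := proper_sub pB.
  pose X' i := if i == cl (~~ d) then Y else X i.
  have H i : i \in S :\ cl d -> (X' i = Y /\ i = cl (~~ d)) \/ (X' i = X i /\ i \in S).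
    by rewrite /X' => /setD1P[_ iS]; case: eqP => [->|_]; [left | right].
  have := IH B (S :\ cl d) X' (sub_card _ pB) (lost d B BA av).
  rewrite (sumX X' d); last first.
    move=> i; rewrite -(two d) /X' => /setD1P[ni _].
    by rewrite (negbTE ni).
  have -> : X' (cl (~~ d)) = Y by rewrite /X' eqxx.
  rewrite cS1 expnS mulnCA addnA; apply.
  + by move=> i /H[[-> _]|[-> /Xn]].
  + by move=> i /H[[-> _]|[-> /dXA]] //; apply: disjB.
  + move=> i /H[[-> ->]|[-> iS]] // x y xX yB.
    by apply: cXA => //; apply: (subsetP BA).
- move=> B Y pB Yn dYB cYB; have BA := proper_sub pB.
  pose X' i := if i == a then Y true else if i == b then Y false else X i.
  have H i : i \in S -> (exists d, X' i = Y d /\ i = cl d) \/ X' i = X i.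
    move=> iS; rewrite /X'; case: eqP => [->|_]; first by left; exists true.
    by case: eqP => [->|_]; [left; exists false | right].
  have := IH B S X' (sub_card _ pB) _.
  rewrite (big_setD1 a) //= -[S :\ a]/(S :\ cl true) (sumX X' true); last first.
    by move=> i /setD1P[nb /setD1P[na _]]; rewrite /X' (negbTE na) (negbTE nb).
  have -> : X' a = Y true by rewrite /X' eqxx.
  have -> : X' (cl (~~ true)) = Y false.
    by rewrite /X' /= (negbTE (cl_neq false)) eqxx.
  rewrite cS !expnS !addnA.
  have -> : n * (2 * (2 * 2 ^ s0)) = 4 * (n * 2 ^ s0) by arith.
  apply.
  + by move=> x y xB yB; apply: colA; apply: (subsetP BA).
  + by move=> i iS; case: (H i iS) => [[d [-> _]]|->] //; apply: Xn.
  + by move=> i iS; case: (H i iS) => [[d [-> _]]|->] //; apply: disjB => //; apply: dXA.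
  + move=> i iS; case: (H i iS) => [[d [-> ->]]|->] // x y xX yB.
    by apply: cXA => //; apply: (subsetP BA).
Qed.

Lemma has_mono_copy_cycle N k (c : 'I_N -> 'I_N -> 'I_k) i l : 0 < l ->
  (forall x y, c x y = c y x) -> has_cycle (fun x y => c x y == i) l ->
  has_mono_copy c (cycle_graph l).
Proof.
move=> l0 c_sym /(periodic_of_cycle l0)[f fl]; exists i, (fun u : 'I_l => f u); split.
  move=> u v /eqP; rewrite fl.2 !modn_small // => /eqP uv.
  exact: val_inj.
have succ (u : 'I_l) : c (f u) (f (ordS u)) = i.
  have -> : f (ordS u) = f u.+1 by apply/eqP; rewrite fl.2 modn_mod.
  exact/eqP/fl.1.
by move=> u v /andP[_ /orP[]/eqP->]; rewrite ?succ // c_sym succ.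
Qed.

Lemma gallai_arrow_cycle n k : 3 < n <= 5 ->
  gallai_arrow k (cycle_graph (2 * n + 1)) (n * 2 ^ k + 1).
Proof.
move=> /andP[n4 n5] c [c_sym no_rainbow].
have [/existsP[i /existsP[s /andP[us cs]]]|none] := boolP [exists i,
    exists s : (2 * n + 1).-tuple 'I_(n * 2 ^ k + 1),
    uniq s && cycle (fun x y => c x y == i) s].
  apply: (has_mono_copy_cycle (i := i)); rewrite ?addn1 //.
  by exists s; split; rewrite // size_tuple addn1.
have no_cycle i : ~ has_cycle (fun x y => c x y == i) (2 * n + 1).
  move=> [s [us /eqP ss cs]]; case/negP: none; apply/existsP; exists i.
  by apply/existsP; exists (Tuple ss); rewrite us.
have gallai x y z : x != y -> y != z -> x != z ->
    [|| c x y == c y z, c y z == c x z | c x y == c x z].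
  move=> xy yz xz; have := no_rainbow x y z.
  by rewrite /rainbow_triangle xy yz xz -!negb_or /= negbK.
have := attached_bound (A := setT) (S := setT) (X := fun=> set0) c_sym gallai n4 n5
  no_cycle.
rewrite big1 => [|i _]; last by rewrite cards0.
rewrite !cardsT !card_ord addn0 => H.
exfalso; suff : n * 2 ^ k + 1 <= n * 2 ^ k by rewrite addn1 ltnn.
apply: H => // i _.
- by rewrite cards0; apply: ltn_trans n4.
- by rewrite -setI_eq0 set0I.
- by move=> x y; rewrite in_set0.
Qed.

(** * The lower bound *)

Section LowerBound.
Variables (n k : nat).
Hypothesis n0 : 0 < n.

(* Blocks of size [n * 2 ^ t.+1]: color [t] joins the two halves of a block,
   and color 0 also fills the blocks of size [2 * n]. *)
Definition same_block (t x y : nat) : bool :=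
  x %/ (n * 2 ^ t.+1) == y %/ (n * 2 ^ t.+1).

Lemma same_block_mono t t' x y : t <= t' -> same_block t x y -> same_block t' x y.
Proof.
move=> /subnK <-; elim: (t' - t) => [//|d IH] /IH; rewrite /same_block addSn.
by rewrite (expnS 2 (_ + _).+1) [2 * _]mulnC mulnA !divnMA => /eqP->.
Qed.

Lemma same_block_sym t x y : same_block t x y = same_block t y x.
Proof. exact: eq_sym. Qed.

Lemma same_block_trans t x y z :
  same_block t x y -> same_block t y z -> same_block t x z.
Proof. by rewrite /same_block => /eqP->. Qed.

Definition level (x y : nat) : nat := find (fun t => same_block t x y) (iota 0 k).

Lemma level_le t x y : t < k -> (level x y <= t) = same_block t x y.
Proof.
move=> tk; apply/idP/idP => [lt|sb].
  have fk : level x y < size (iota 0 k) by rewrite size_iota; apply: leq_ltn_trans tk.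
  apply: same_block_mono lt _; have := fk; rewrite /level -has_find => /(nth_find 0).
  by rewrite nth_iota ?add0n // -[X in _ < X](size_iota 0).
rewrite leqNgt; apply/negP => /(before_find 0); rewrite nth_iota // add0n.
by rewrite sb.
Qed.

Lemma level_sym x y : level x y = level y x.
Proof. by apply: eq_find => t; apply: same_block_sym. Qed.

Lemma level_ultra x y z : level x z <= maxn (level x y) (level y z).
Proof.
have [big|small] := leqP k (maxn (level x y) (level y z)).
  apply: leq_trans big.
  by have := find_size (fun t => same_block t x z) (iota 0 k); rewrite size_iota.
rewrite level_le //; apply: (@same_block_trans _ _ y);
by rewrite -level_le // ?leq_maxl ?leq_maxr.
Qed.

End LowerBound.

Definition level_coloring n k (x y : 'I_(n * 2 ^ k.+1)) : 'I_k.+1 :=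
  inord (level n k.+1 x y).

Lemma level_lt n k (x y : 'I_(n * 2 ^ k.+1)) : level n k.+1 x y < k.+1.
Proof.
by rewrite ltnS level_le // /same_block !divn_small.
Qed.

Lemma level_coloring_gallai n k : gallai_coloring (@level_coloring n k).
Proof.
split=> [x y|x y z]; first by rewrite /level_coloring level_sym.
apply/negP => /and5P[_ _ _ c1 /andP[c2 c3]].
have neq (u v u' v' : 'I_(n * 2 ^ k.+1)) :
    @level_coloring n k u v != level_coloring u' v' ->
    level n k.+1 u v != level n k.+1 u' v'.
  by apply: contraNneq; rewrite /level_coloring => ->.
move: c1 c2 c3 => /neq c1 /neq c2 /neq c3.
have := level_ultra n k.+1 x y z; have := level_ultra n k.+1 y x z.
have := level_ultra n k.+1 x z y.
rewrite (level_sym n k.+1 z y) (level_sym n k.+1 y x).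
move: (level _ _ _ _) (level _ _ _ _) (level _ _ _ _) c1 c2 c3 => p q r.
by clear; lia.
Qed.

Lemma level_coloring_no_odd_cycle n k : 0 < n ->
  ~ has_mono_copy (@level_coloring n k) (cycle_graph (2 * n + 1)).
Proof.
move=> n0 [i [f [f_inj fi]]]; set L := 2 * n + 1 in f f_inj fi.
have succ (u : 'I_L) : level n k.+1 (f u) (f (ordS u)) = i.
  rewrite -(fi u (ordS u)) /= ?inordK ?level_lt //.
  rewrite /cycle_adj eqxx /= andbT; apply/eqP => /(congr1 val) /= Eu.
  have := ltn_ord u; rewrite leq_eqVlt => /orP[/eqP uL|uL].
    by rewrite uL modnn in Eu; move: uL; rewrite Eu /L; clear -n0; lia.
  by move: Eu; rewrite modn_small // => /n_Sn.
have L0 : 0 < L by rewrite /L addn1.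
pose h j : 'I_L := Ordinal (ltn_pmod j L0); pose g j := f (h j).
have hS j : h j.+1 = ordS (h j).
  by apply: val_inj; rewrite /= -(addn1 (j %% L)) modnDml addn1.
have gS j : level n k.+1 (g j) (g j.+1) = i by rewrite /g hS.
have gE (u : 'I_L) : f u = g u by congr f; apply: val_inj; rewrite /= modn_small.
case: (nat_of_ord i) (ltn_ord i) gS => [|t] tk gS.
  have block0 j : same_block n 0 (g 0) (g j).
    elim: j => [|j IH]; first exact: eqxx.
    by apply: same_block_trans IH _; rewrite -(level_le _ _ _ tk) gS.
  have n2 : 0 < n * 2 ^ 1 by rewrite muln_gt0 n0.
  pose r (u : 'I_L) := Ordinal (ltn_pmod (f u) n2).
  have r_inj : injective r.
    move=> u v /(congr1 val) /= ruv; apply: f_inj; apply: val_inj => /=.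
    have /eqP Eu := block0 u; have /eqP Ev := block0 v.
    rewrite -gE in Eu; rewrite -gE in Ev.
    by rewrite (divn_eq (f u) (n * 2 ^ 1)) ruv -Eu Ev -divn_eq.
  by have := leq_card r r_inj; rewrite !card_ord /L expn1; lia.
pose q j := g j %/ (n * 2 ^ t.+1).
have flip j : odd (q j.+1) = ~~ odd (q j).
  have same : same_block n t.+1 (g j) (g j.+1) by rewrite -(level_le _ _ _ tk) gS.
  have diff : ~~ same_block n t (g j) (g j.+1).
    by rewrite -(level_le _ _ _ (ltnW tk)) gS ltnn.
  move: same diff; rewrite /same_block (expnS 2 t.+1) (mulnC 2) mulnA.
  rewrite !(divnMA _ (n * 2 ^ t.+1)) -/(q j) -/(q j.+1); clear; lia.
have parity j : odd (q j) = odd (q 0) (+) odd j.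
  by elim: j => [|j IH]; rewrite ?addbF // flip IH /= addbN.
have := parity L; have -> : q L = q 0.
  by rewrite /q /g; congr (nat_of_ord (f _) %/ _); apply: val_inj; rewrite /= modnn mod0n.
by rewrite /L oddD mul2n odd_double; case: (odd _).
Qed.

Theorem theorem1p8 (n k : nat) (hn : n = 4 \/ n = 5) (hk : 1 <= k) :
  is_gallai_ramsey k (cycle_graph (2 * n + 1)) (n * 2 ^ k + 1) /\
  (forall c : 'I_(n * 2 ^ k + 1) -> 'I_(n * 2 ^ k + 1) -> 'I_k,
     gallai_coloring c -> has_mono_copy c (cycle_graph (2 * n + 1))) /\
  (exists c : 'I_(n * 2 ^ k) -> 'I_(n * 2 ^ k) -> 'I_k,
     gallai_coloring c /\ ~ has_mono_copy c (cycle_graph (2 * n + 1))).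
Proof.
have n45 : 3 < n <= 5 by case: hn => ->.
have n0 : 0 < n by case: hn => ->.
have upper := @gallai_arrow_cycle n k n45.
case: k hk upper => // k _ upper.
have [g_gallai g_free] :=
  (@level_coloring_gallai n k, @level_coloring_no_odd_cycle n k n0).
split; last by split=> //; exists (@level_coloring n k).
split=> [|//|M M0 arrow]; first by rewrite addn1.
rewrite leqNgt addn1 ltnS; apply/negP => MN.
pose w := widen_ord MN; have w_inj : injective w by move=> x y /(congr1 val) /= /ord_inj.
have [sym nr] := g_gallai.
have [|i [f [f_inj fi]]] := arrow (fun x y => level_coloring (w x) (w y)).
  split=> [x y|x y z]; first exact: sym.
  by have := nr (w x) (w y) (w z); rewrite /rainbow_triangle !(inj_eq w_inj).
by apply: g_free; exists i, (w \o f); split=> //; apply: inj_comp.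
Qed.
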